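(* Let $\Bbbk$ be a field and let $A=A_\mu(R,\boldsymbol\partial,\mathbf a)$ be a twisted generalized Weyl Poisson algebra (TGWPA) of type $(A_1)^n$, with scalars $\gamma_{ij}$ given by $\partial_j(a_i)=\gamma_{ij}a_i$ for $i\ne j$. Let $\phi$ be a Poisson automorphism of $A$ such that: (i) $\phi|_R$ is an automorphism of $R$ of finite order $\ell$; (ii) for each $i\in[n]$, $\phi(x_i)=\alpha_ix_i$ and $\phi(y_i)=\alpha_i^{-1}y_i$ for some $\alpha_i\in\Bbbk^\times$ of finite multiplicative order $m_i$; (iii) the integers $\ell,m_1,\dots,m_n$ are pairwise relatively prime. Define $\boldsymbol\delta=(\delta_1,\dots,\delta_n)$ and $\mathbf b=(b_1,\dots,b_n)$ by $\delta_i=m_i\partial_i$ (restricted to $R^{\langle\phi|_R\rangle}$) and $b_i=a_i^{m_i}$ for $i\in[n]$, and set $\nu_{ij}=m_im_j\mu_{ij}$ and $\eta_{ij}=m_im_j\gamma_{ij}$ for $i\ne j$. Then the invariant ring $B=A^{\langle\phi\rangle}$ is a TGWPA and $B\cong A_\nu(R^{\langle\phi|_R\rangle},\boldsymbol\delta,\mathbf b)$ as Poisson algebras, with $\eta_{ij}$ in the role of $\gamma_{ij}$.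
   Context: All algebras are over a field $\Bbbk$; $[n]=\{1,\dots,n\}$. A Poisson algebra is a commutative algebra $R$ with a Lie bracket $\{,\}$ such that each $\{r,-\}$ is a derivation; a Poisson automorphism is an algebra automorphism preserving the bracket. A derivation $\partial$ of $R$ is a Poisson derivation if $\partial(\{r,s\})=\{\partial(r),s\}+\{r,\partial(s)\}$ for all $r,s$. An element $a$ is Poisson central if $\{a,-\}=0$. For an automorphism $\phi$ of $A$, $A^{\langle\phi\rangle}$ is the subalgebra of elements fixed by $\phi$. TGWPA of type $(A_1)^n$: Fix an integer $n\ge 1$. Let $R$ be a Poisson algebra, $\boldsymbol\partial=(\partial_1,\dots,\partial_n)$ an $n$-tuple of pairwise commuting Poisson derivations of $R$, and $\mathbf a=(a_1,\dots,a_n)$ an $n$-tuple of Poisson central regular (non-zero-divisor) elements of $R$. Assume there are scalars $\mu_{ij},\gamma_{ij}\in\Bbbk$ ($i\ne j$) with $\partial_j(a_i)=\gamma_{ij}a_i$ and $\gamma_{ij}+\gamma_{ji}=\mu_{ij}+\mu_{ji}$ for all $i\neq j$. Then $A_\mu(R,\boldsymbol\partial,\mathbf a)$ is the algebra $R[x_1,y_1,\dots,x_n,y_n]/(y_1x_1-a_1,\dots,y_nx_n-a_n)$ with Poisson bracket extending that of $R$ and given by $\{r,x_i\}=\partial_i(r)x_i$, $\{r,y_i\}=-\partial_i(r)y_i$, $\{y_i,x_i\}=\partial_i(a_i)$ for $i\in[n]$, $r\in R$, and $\{y_i,x_j\}=\mu_{ij}x_jy_i$, $\{x_i,x_j\}=(\gamma_{ij}-\mu_{ij})x_ix_j$,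 $\{y_i,y_j\}=(\mu_{ji}-\gamma_{ij})y_iy_j$ for $i\ne j$ in $[n]$. *)

(* Defs.v *)
From HB Require Import structures.
From mathcomp Require Import all_boot all_algebra.
From mathcomp Require Import boolp mpoly.
Set Implicit Arguments.
Unset Strict Implicit.
Unset Printing Implicit Defensive.
From mathcomp Require Import ring.
Import GRing.Theory.
Local Open Scope ring_scope.

(* [pbr_linearl], [pbr_linearr], [pbrrr] and [pbr_jacobi] say that [pbr] is a
   k-Lie bracket; the alternating law is stated in the form valid in every
   characteristic. *)
HB.mixin Record isPoisson (k : fieldType) R of GRing.ComAlgebra k R := {
  pbr : R -> R -> R;
  pbr_linearl : forall s, linear (pbr^~ s);
  pbr_linearr : forall r, linear (pbr r);
  pbrrr : forall r, pbr r r = 0;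
  pbr_jacobi : forall r s t,
    pbr r (pbr s t) + pbr s (pbr t r) + pbr t (pbr r s) = 0;
  pbrMr : forall r s t, pbr r (s * t) = pbr r s * t + s * pbr r t
}.

#[short(type="poissonAlgType")]
HB.structure Definition PoissonAlgebra (k : fieldType) :=
  {R of isPoisson k R & GRing.ComAlgebra k R}.

Notation "{{ r , s }}" := (pbr r s)
  (at level 0, r, s at level 99, format "{{ r ,  s }}") : ring_scope.

HB.mixin Record isPoissonMorphism (k : fieldType) (A B : poissonAlgType k)
    (f : A -> B) := {
  pmorph : forall u v, f {{u, v}} = {{f u, f v}}
}.

#[short(type="pmorphism")]
HB.structure Definition PoissonMorphism (k : fieldType)
    (A B : poissonAlgType k) :=
  {f of @GRing.LRMorphism k A B *:%R f & isPoissonMorphism k A B f}.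

Notation "{ 'poisson' A -> B }" := (pmorphism A B)
  (at level 0, A at level 98, B at level 99, format "{ 'poisson'  A  ->  B }") : type_scope.

Section PoissonTheory.
Variables (k : fieldType) (R : poissonAlgType k).
Implicit Types r s t : R.

Lemma pbrDr r s t : {{r, s + t}} = {{r, s}} + {{r, t}}.
Proof. by have := pbr_linearr r 1 s t; rewrite !scale1r. Qed.

Lemma pbrDl r s t : {{r + s, t}} = {{r, t}} + {{s, t}}.
Proof. by have := pbr_linearl t 1 r s; rewrite !scale1r. Qed.

Lemma pbrC r s : {{r, s}} = - {{s, r}}.
Proof.
apply/eqP; rewrite -addr_eq0; apply/eqP.
by have := pbrrr (r + s); rewrite pbrDl !pbrDr !pbrrr add0r addr0.
Qed.

Lemma pbrMl r s t : {{r * s, t}} = {{r, t}} * s + r * {{s, t}}.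
Proof. by rewrite pbrC pbrMr !(pbrC t); ring. Qed.

Lemma pbr_in_alg r (c : k) : {{r, c%:A}} = 0.
Proof.
have br1 : {{r, 1}} = 0.
  by have := pbrMr r 1 1; rewrite !mulr1 mul1r -[LHS]addr0 => /addrI.
have br0 : {{r, 0}} = 0.
  by have := pbrDr r 0 0; rewrite addr0 -[LHS]addr0 => /addrI.
by have := pbr_linearr r c 1 0; rewrite addr0 br1 br0 scaler0 addr0.
Qed.

Lemma pbrZr (c : k) r s : {{r, c *: s}} = c *: {{r, s}}.
Proof. by rewrite -mulr_algl pbrMr pbr_in_alg mul0r add0r mulr_algl. Qed.

Lemma pbrZl (c : k) r s : {{c *: r, s}} = c *: {{r, s}}.
Proof. by rewrite pbrC pbrZr -scalerN -pbrC. Qed.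

Definition poisson_derivation (d : R -> R) : Prop :=
  [/\ linear d,
      forall r s, d (r * s) = d r * s + r * d s &
      forall r s, d {{r, s}} = {{d r, s}} + {{r, d s}}].

Definition poisson_central (a : R) : Prop := forall r, {{a, r}} = 0.

End PoissonTheory.

Definition has_order (T : Type) (f : T -> T) (l : nat) : Prop :=
  [/\ (0 < l)%N, iter l f =1 id &
      forall j, (0 < j < l)%N -> ~ (iter j f =1 id)].

Definition poisson_iso (k : fieldType) (A B : poissonAlgType k) : Prop :=
  exists f : {poisson A -> B}, bijective f.

(* The Poisson subalgebra A^<phi>: being fixed by phi and being fixed by the
   group generated by phi are the same condition. *)
Section Fixed.
Variables (k : fieldType) (A : poissonAlgType k) (phi : {poisson A -> A}).

Definition fixed_pred : {pred A} := [pred u | phi u == u].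

Fact fixed_subalg_closed : subalg_closed fixed_pred.
Proof.
split=> [|c u v|u v]; rewrite !inE ?rmorph1 //.
  by move=> /eqP hu /eqP hv; rewrite linearP /= hu hv.
by move=> /eqP hu /eqP hv; rewrite rmorphM /= hu hv.
Qed.
HB.instance Definition _ := GRing.isSubalgClosed.Build k A fixed_pred fixed_subalg_closed.

Fact fixed_pbr u v : u \in fixed_pred -> v \in fixed_pred -> {{u, v}} \in fixed_pred.
Proof. by rewrite !inE pmorph => /eqP-> /eqP->. Qed.

Record fixed := Fixed { fixed_val :> A; _ : fixed_val \in fixed_pred }.
HB.instance Definition _ := [isSub for fixed_val].
HB.instance Definition _ := [Choice of fixed by <:].
HB.instance Definition _ := [SubChoice_isSubComNzRing of fixed by <:].
HB.instance Definition _ := [SubZmodule_isSubLmodule of fixed by <:].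
HB.instance Definition _ := [SubNzRing_SubLmodule_isSubLalgebra of fixed by <:].
HB.instance Definition _ := [SubLalgebra_isSubAlgebra of fixed by <:].

Definition fixed_br (u v : fixed) : fixed := Fixed (fixed_pbr (valP u) (valP v)).
Fact fixed_br_linearl v : linear (fixed_br^~ v).
Proof. by move=> c u w; apply: val_inj; exact: pbr_linearl. Qed.
Fact fixed_br_linearr u : linear (fixed_br u).
Proof. by move=> c v w; apply: val_inj; exact: pbr_linearr. Qed.
Fact fixed_brrr u : fixed_br u u = 0.
Proof. by apply: val_inj; rewrite /= pbrrr. Qed.
Fact fixed_br_jacobi u v w : 
  fixed_br u (fixed_br v w) + fixed_br v (fixed_br w u) + fixed_br w (fixed_br u v) = 0.
Proof. by apply: val_inj; rewrite /= pbr_jacobi. Qed.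
Fact fixed_brMr u v w : fixed_br u (v * w) = fixed_br u v * w + v * fixed_br u w.
Proof. by apply: val_inj; rewrite /= pbrMr. Qed.
HB.instance Definition _ := isPoisson.Build k fixed
  fixed_br_linearl fixed_br_linearr fixed_brrr fixed_br_jacobi fixed_brMr.
End Fixed.

Section MpolyDerivation.
Variables (R : comNzRingType) (N : nat).
Local Notation P := {mpoly R[N]}.

Definition is_der (D : P -> P) :=
  {morph D : p q / p + q} /\ (forall p q, D (p * q) = D p * q + p * D q).

Lemma mpoly_gen_ind (Q : P -> Prop) :
  (forall c, Q c%:MP) -> (forall s, Q 'X_s) ->
  (forall p q, Q p -> Q q -> Q (p + q)) ->
  (forall p q, Q p -> Q q -> Q (p * q)) -> forall p, Q p.
Proof.
move=> QC QX QD QM; elim/mpolyind=> [|c m p _ _ Qp]; first by rewrite -mpolyC0.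
apply: (QD) => //; rewrite -mul_mpolyC; apply: (QM) => //.
rewrite mpolyXE_id; elim/big_rec: _ => [|s q _ Qq]; first by rewrite -mpolyC1.
apply: (QM) => //; elim: (m s) => [|j IHj]; first by rewrite expr0 -mpolyC1.
by rewrite exprS; apply: (QM).
Qed.

Lemma is_der_eq0 D : is_der D ->
  (forall c, D c%:MP = 0) -> (forall s, D 'X_s = 0) -> forall p, D p = 0.
Proof.
move=> [DD DM] DC DX; elim/mpoly_gen_ind => // p q Dp Dq.
  by rewrite DD Dp Dq addr0.
by rewrite DM Dp Dq mul0r mulr0 addr0.
Qed.

Lemma is_derN D : is_der D -> is_der (fun p => - D p).
Proof.
move=> [DD DM]; split=> p q; first by rewrite DD opprD.
by rewrite DM opprD mulNr mulrN.
Qed.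

Lemma is_derD D D' : is_der D -> is_der D' -> is_der (fun p => D p + D' p).
Proof.
move=> [DD DM] [DD' DM']; split=> p q; first by rewrite DD DD'; ring.
by rewrite DM DM'; ring.
Qed.

Lemma is_derMr D r : is_der D -> is_der (fun p => D p * r).
Proof. by move=> [DD DM]; split=> p q; rewrite (DD, DM); ring. Qed.

Lemma is_der_sum (I : Type) (l : seq I) (D : I -> P -> P) :
  (forall i, is_der (D i)) -> is_der (fun p => \sum_(i <- l) D i p).
Proof.
move=> Dder; elim: l => [|i l IHl].
  by split=> p q; rewrite !big_nil ?addr0 // mul0r mulr0 addr0.
have := is_derD (Dder i) IHl.
by case=> DD DM; split=> p q; rewrite !big_cons (DD, DM).
Qed.

(* The derivation of R[X] extending [d : R -> R[X]] with ['X_s |-> v s]. *)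
Definition mder (d : R -> P) (v : 'I_N -> P) (p : P) : P :=
  mmap d (fun s => 'X_s) p + \sum_s v s * p^`M(s).

Section Mder.
Variables (d : R -> P) (v : 'I_N -> P).
Hypothesis dD : {morph d : c c' / c + c'}.
Hypothesis dM : forall c c', d (c * c') = d c * c'%:MP + c%:MP * d c'.

Let d1 : d 1 = 0.
Proof. by have := dM 1 1; rewrite !mulr1 mul1r -[LHS]addr0 => /addrI. Qed.

Let d0 : d 0 = 0.
Proof. by have := dD 0 0; rewrite addr0 -[LHS]addr0 => /addrI. Qed.

Let dB : zmod_morphism d.
Proof.
move=> c c'; rewrite dD; congr (_ + _); apply/eqP.
by rewrite -addr_eq0 -dD addrC subrr d0.
Qed.

Let E : P -> P := mmap d (fun s => 'X_s).

Let EB : zmod_morphism E.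
Proof.
pose df : {additive R -> P} := HB.pack d (GRing.isZmodMorphism.Build R P d dB).
exact: (mmap_is_additive (fun s => 'X_s) df).
Qed.

Let E0 : E 0 = 0.
Proof. by have := EB 0 0; rewrite !subrr. Qed.

Let ED : {morph E : p q / p + q}.
Proof.
have EN q : E (- q) = - E q by rewrite -sub0r EB E0 sub0r.
by move=> p q; rewrite -{1}[q]opprK EB EN opprK.
Qed.

Let EX c m : E (c *: 'X_[m]) = d c * 'X_[m].
Proof.
rewrite /E /mmap; have [->|c0] := eqVneq c 0.
  by rewrite scale0r msupp0 big_nil d0 mul0r.
by rewrite msuppMCX // big_seq1 mcoeffZ mcoeffX eqxx mulr1 mmap1_id.
Qed.

Let EM p q : E (p * q) = E p * q + p * E q.
Proof.
elim/mpolyind: p => [|c m p _ _ IHp]; first by rewrite mul0r E0 !mul0r addr0.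
rewrite mulrDl !ED IHp.
suff -> : E (c *: 'X_[m] * q) = E (c *: 'X_[m]) * q + c *: 'X_[m] * E q by ring.
elim/mpolyind: q {IHp} => [|c' m' q _ _ IHq]; first by rewrite mulr0 E0 !mulr0 addr0.
rewrite mulrDr !ED IHq.
have -> : (c *: 'X_[m]) * (c' *: 'X_[m']) = (c * c') *: 'X_[(m + m')%MM] :> P.
  by rewrite -scalerAl -scalerAr scalerA mpolyXD.
by rewrite !EX dM mpolyXD -!mul_mpolyC; ring.
Qed.

Lemma mder_is_der : is_der (mder d v).
Proof.
apply: is_derD; first by split; [exact: ED|exact: EM].
apply: is_der_sum => s; split=> p q; first by rewrite mderivD mulrDr.
by rewrite mderivM; ring.
Qed.

Lemma mderC c : mder d v c%:MP = d c.
Proof.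
rewrite /mder big1 ?addr0 => [|s _]; last by rewrite mderivC mulr0.
have := EX c 0%MM; rewrite mpolyX0 /E mulr1 => <-.
by rewrite -mul_mpolyC mulr1.
Qed.

Lemma mderX s : mder d v 'X_s = v s.
Proof.
rewrite /mder (bigD1 s) //= big1 => [|t ts].
  have := EX 1 U_(s)%MM; rewrite scale1r d1 mul0r /E => ->.
  rewrite add0r addr0 mderivX mnm1E eqxx scale1r.
  have -> : (U_(s) - U_(s) = 0)%MM by apply/mnmP=> j; rewrite mnmBE mnm0E subnn.
  by rewrite mpolyX0 mulr1.
by rewrite mderivX mnm1E eq_sym (negPf ts) scale0r mulr0.
Qed.
End Mder.
End MpolyDerivation.

Section Jacobiator.
Variables (P : comNzRingType) (br : P -> P -> P).
Hypothesis brDr : forall p q r, br p (q + r) = br p q + br p r.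
Hypothesis brMr : forall p q r, br p (q * r) = br p q * r + q * br p r.
Hypothesis br_asym : forall p q, br p q = - br q p.

Definition jacobiator p q r := br p (br q r) + br q (br r p) + br r (br p q).

Let brDl p q r : br (q + r) p = br q p + br r p.
Proof. by rewrite br_asym brDr opprD -!br_asym. Qed.
Let brMl p q r : br (q * r) p = br q p * r + q * br r p.
Proof. by rewrite br_asym brMr opprD -mulNr -mulrN -!br_asym. Qed.
Let br0r p : br p 0 = 0.
Proof. by have := brDr p 0 0; rewrite addr0 -[LHS]addr0 => /addrI. Qed.
Let brNr p q : br p (- q) = - br p q.
Proof. by apply/eqP; rewrite -addr_eq0 addrC -brDr subrr br0r. Qed.

Lemma jacobiator_cyc p q r : jacobiator p q r = jacobiator q r p.
Proof. by rewrite /jacobiator [RHS]addrC addrA. Qed.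

Lemma jacobiator_der p q :
  {morph jacobiator p q : r s / r + s} /\
  (forall r s, jacobiator p q (r * s) = jacobiator p q r * s + r * jacobiator p q s).
Proof.
split=> r s; rewrite /jacobiator.
  by rewrite !(brDr, brDl); ring.
rewrite !(brMr, brMl, brDr, brDl) (br_asym r p) (br_asym s p) !brNr.
by ring.
Qed.
End Jacobiator.

Section MpolyBracket.
Variables (k : fieldType) (R : poissonAlgType k) (N : nat).
Variables (th : 'I_N -> R -> R) (kap : 'I_N -> 'I_N -> k) (e : 'I_N -> 'I_N -> R).
Local Notation P := {mpoly R[N]}.

Definition mbr_var (s t : 'I_N) : P :=
  (kap s t)%:A *: ('X_s * 'X_t) + (e s t)%:MP.

(* [ham_coef c] is {c, -} and [ham_var s] is {'X_s, -}. *)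
Definition ham_coef (c : R) : P -> P :=
  mder (fun c' => {{c, c'}}%:MP) (fun s => th s c *: 'X_s).
Definition ham_var (s : 'I_N) : P -> P :=
  mder (fun c => - (th s c *: 'X_s)) (mbr_var s).

(* The biderivation of R[X] extending the bracket of R, with
   {c, 'X_s} = th s c *: 'X_s and {'X_s, 'X_t} = mbr_var s t. *)
Definition mbr (p : P) : P -> P :=
  mder (fun c => - ham_coef c p) (fun s => - ham_var s p).

Hypothesis th_der : forall s, poisson_derivation (th s).
Hypothesis th_comm : forall s t c, th s (th t c) = th t (th s c).
Hypothesis kap_asym : forall s t, kap s t = - kap t s.
Hypothesis e_asym : forall s t, e s t = - e t s.
Hypothesis kap0 : forall s, kap s s = 0.
Hypothesis e0 : forall s, e s s = 0.
Hypothesis e_central : forall s t, poisson_central (e s t).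
Hypothesis e_weight : forall s t c, (th s c + th t c) * e s t = 0.
Hypothesis e_kap : forall s t u, s != t -> s != u ->
  th s (e t u) = (kap u s + kap t s) *: e t u.

Let thD s c c' : th s (c + c') = th s c + th s c'.
Proof. by case: (th_der s) => l _ _; have := l 1 c c'; rewrite !scale1r. Qed.
Let thM s c c' : th s (c * c') = th s c * c' + c * th s c'.
Proof. by case: (th_der s). Qed.
Let thB s c c' : th s {{c, c'}} = {{th s c, c'}} + {{c, th s c'}}.
Proof. by case: (th_der s). Qed.
Let thA s (a : k) : th s a%:A = 0.
Proof.
have th1 : th s 1 = 0.
  by have := thM s 1 1; rewrite !mulr1 mul1r -[LHS]addr0 => /addrI.
have th0 : th s 0 = 0.
  by have := thD s 0 0; rewrite addr0 -[LHS]addr0 => /addrI.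
by case: (th_der s) => l _ _; have := l a 1 0; rewrite addr0 th1 scaler0 th0 addr0.
Qed.

Lemma ham_coef_der c : is_der (ham_coef c).
Proof.
apply: mder_is_der => c' c''; first by rewrite pbrDr mpolyCD.
by rewrite pbrMr mpolyCD !mpolyCM.
Qed.
Lemma ham_var_der s : is_der (ham_var s).
Proof.
apply: mder_is_der => c' c''; first by rewrite thD scalerDl opprD.
by rewrite thM -!mul_mpolyC mpolyCD !mpolyCM; ring.
Qed.
Lemma ham_coefC c c' : ham_coef c c'%:MP = {{c, c'}}%:MP.
Proof.
by apply: mderC => x y; rewrite pbrDr mpolyCD.
Qed.
Lemma ham_coefX c s : ham_coef c 'X_s = th s c *: 'X_s.
Proof.
apply: mderX => x y; first by rewrite pbrDr mpolyCD.
by rewrite pbrMr mpolyCD !mpolyCM.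
Qed.
Lemma ham_varC s c : ham_var s c%:MP = - (th s c *: 'X_s).
Proof.
by apply: mderC => x y; rewrite thD scalerDl opprD.
Qed.
Lemma ham_varX s t : ham_var s 'X_t = mbr_var s t.
Proof.
apply: mderX => x y; first by rewrite thD scalerDl opprD.
by rewrite thM -!mul_mpolyC mpolyCD !mpolyCM; ring.
Qed.

Lemma ham_coefDl c c' p : ham_coef (c + c') p = ham_coef c p + ham_coef c' p.
Proof.
apply/eqP; rewrite -subr_eq0; apply/eqP; move: p; apply: is_der_eq0.
- exact: is_derD (ham_coef_der _) (is_derN (is_derD (ham_coef_der _) (ham_coef_der _))).
- by move=> x; rewrite !ham_coefC pbrDl mpolyCD subrr.
- by move=> s; rewrite !ham_coefX thD scalerDl subrr.
Qed.
Lemma ham_coefMl c c' p :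
  ham_coef (c * c') p = ham_coef c p * c'%:MP + ham_coef c' p * c%:MP.
Proof.
apply/eqP; rewrite -subr_eq0; apply/eqP; move: p; apply: is_der_eq0.
- exact: is_derD (ham_coef_der _)
   (is_derN (is_derD (is_derMr _ (ham_coef_der _)) (is_derMr _ (ham_coef_der _)))).
- by move=> x; rewrite !ham_coefC pbrMl mpolyCD !mpolyCM; ring.
- by move=> s; rewrite !ham_coefX thM -!mul_mpolyC mpolyCD !mpolyCM; ring.
Qed.

Lemma mbr_der p : is_der (mbr p).
Proof.
apply: mder_is_der => c c'; first by rewrite ham_coefDl opprD.
by rewrite ham_coefMl; ring.
Qed.
Lemma mbrC p c : mbr p c%:MP = - ham_coef c p.
Proof.
by apply: mderC => x y; rewrite ham_coefDl opprD.
Qed.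
Lemma mbrX p s : mbr p 'X_s = - ham_var s p.
Proof.
apply: mderX => x y; first by rewrite ham_coefDl opprD.
by rewrite ham_coefMl; ring.
Qed.

Lemma mbr_derl q : is_der (fun p => mbr p q).
Proof.
apply: is_derD.
  apply: is_der_sum => m; apply: is_derMr.
  exact: is_derN (ham_coef_der _).
by apply: is_der_sum => s; apply: is_derMr; apply: is_derN (ham_var_der _).
Qed.

Lemma mbrCC c c' : mbr c%:MP c'%:MP = {{c, c'}}%:MP.
Proof. by rewrite mbrC ham_coefC -mpolyCN -pbrC. Qed.
Lemma mbrCX c s : mbr c%:MP 'X_s = th s c *: 'X_s.
Proof. by rewrite mbrX ham_varC opprK. Qed.
Lemma mbrXC c s : mbr 'X_s c%:MP = - (th s c *: 'X_s).
Proof. by rewrite mbrC ham_coefX. Qed.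
Lemma mbrXX s t : mbr 'X_s 'X_t = mbr_var s t.
Proof.
rewrite mbrX ham_varX /mbr_var kap_asym e_asym mpolyCN !scaleNr.
by rewrite -opprD opprK mulrC.
Qed.

Let mbrDr p q r : mbr p (q + r) = mbr p q + mbr p r.
Proof. by case: (mbr_der p). Qed.
Lemma mbrMr p q r : mbr p (q * r) = mbr p q * r + q * mbr p r.
Proof. by case: (mbr_der p). Qed.
Let mbrDl p q r : mbr (q + r) p = mbr q p + mbr r p.
Proof. by case: (mbr_derl p). Qed.
Let mbrMl p q r : mbr (q * r) p = mbr q p * r + q * mbr r p.
Proof. by case: (mbr_derl p). Qed.

Lemma mbr_asym p q : mbr p q = - mbr q p.
Proof.
apply/eqP; rewrite -addr_eq0; apply/eqP; move: q.
have D1 p' : is_der (fun q => mbr p' q + mbr q p').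
  exact: is_derD (mbr_der _) (mbr_derl _).
have D2 q : is_der (fun p' => mbr p' q + mbr q p').
  exact: is_derD (mbr_derl _) (mbr_der _).
apply: is_der_eq0 => // [c|s]; move: p; apply: is_der_eq0 => //.
- by move=> c'; rewrite !mbrCC pbrC mpolyCN addNr.
- by move=> s; rewrite mbrCX mbrXC addNr.
- by move=> c; rewrite mbrCX mbrXC subrr.
- move=> t; rewrite !mbrXX /mbr_var kap_asym e_asym mpolyCN !scaleNr.
  by rewrite -opprD mulrC addNr.
Qed.

Lemma mbrpp p : mbr p p = 0.
Proof.
elim/mpoly_gen_ind: p => [c|s|p q Bp Bq|p q Bp Bq].
- by rewrite mbrCC pbrrr mpolyC0.
- by rewrite mbrXX /mbr_var kap0 e0 scale0r scale0r mpolyC0 addr0.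
- by rewrite mbrDl !mbrDr Bp Bq (mbr_asym p); ring.
- by rewrite mbrMl !mbrMr Bp Bq (mbr_asym p); ring.
Qed.

Let mbr0r p : mbr p 0 = 0.
Proof. by have := mbrDr p 0 0; rewrite addr0 -[LHS]addr0 => /addrI. Qed.
Let mbrNr p q : mbr p (- q) = - mbr p q.
Proof. by apply/eqP; rewrite -addr_eq0 addrC -mbrDr subrr mbr0r. Qed.

Let jac := jacobiator mbr.

Let thA_X s a : mbr 'X_s (a%:A : R)%:MP = 0.
Proof. by rewrite mbrXC thA scale0r oppr0. Qed.

Let mbr_CE c s t : mbr c%:MP (e s t)%:MP = 0.
Proof. by rewrite mbrCC pbrC e_central oppr0 mpolyC0. Qed.

Let varE s t : mbr_var s t = ((kap s t)%:A : R)%:MP * ('X_s * 'X_t) + (e s t)%:MP.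
Proof. by rewrite mul_mpolyC. Qed.

Let jacCCX c c' s : jac c%:MP c'%:MP 'X_s = 0.
Proof.
rewrite /jac /jacobiator mbrCX mbrXC mbrCC mbrNr mbrXC -!mul_mpolyC !mbrMr !mbrCX !mbrCC.
rewrite thB -!mul_mpolyC mpolyCD (pbrC (th s c)) mpolyCN.
by move: ('X_s : P) (_%:MP) (_%:MP) (_%:MP) (_%:MP) => *; ring.
Qed.

Let jacCXX c s t : jac c%:MP 'X_s 'X_t = 0.
Proof.
rewrite /jac /jacobiator mbrXX varE mbrXC mbrCX mbrNr -!mul_mpolyC mbrDr !mbrMr.
rewrite mbr_CE mbrCC pbr_in_alg mpolyC0 !mbrCX !mbrXC !mbrXX -!mul_mpolyC !varE.
rewrite (th_comm t s) kap_asym e_asym !scaleNr !mpolyCN.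
have := congr1 (@mpolyC N R) (e_weight t s c).
rewrite mpolyCM mpolyCD mpolyC0 mulrDl => /addr0_eq.
move:  ('X_s : P) ('X_t : P) (_%:MP) (_%:MP) (_%:MP) (_%:MP) (_%:MP).
move=> x y f g h i j /esym w0; ring: w0.
Qed.

Let jacXXX_neq s t u : s != t -> s != u -> t != u -> jac 'X_s 'X_t 'X_u = 0.
Proof.
move=> st su tu; rewrite /jac /jacobiator !mbrXX !varE !mbrDr !mbrMr !thA_X !mbrXX !varE.
rewrite !mbrXC -!mul_mpolyC.
have ts : t != s by rewrite eq_sym.
have us : u != s by rewrite eq_sym.
have ut : u != t by rewrite eq_sym.
rewrite (e_kap st su) (e_kap tu ts) (e_kap us ut).
rewrite (kap_asym t s) (kap_asym u t) (kap_asym s u) (e_asym t s) (e_asym u t) (e_asym s u).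
rewrite !scalerDl !scaleNr !mpolyCD !mpolyCN.
rewrite -(mulr_algl _ (e t u)) -(mulr_algl _ (e t u)).
rewrite -(mulr_algl _ (e u s)) -(mulr_algl _ (e u s)).
rewrite -(mulr_algl _ (e s t)) -(mulr_algl _ (e s t)) !mpolyCM.
move: ('X_s : P) ('X_t : P) ('X_u : P).
move: ((e s t)%:MP) ((e t u)%:MP) ((e u s)%:MP).
by move: (_%:A%:MP) (_%:A%:MP) (_%:A%:MP) => *; ring.
Qed.

Let jac_diag p r : jac p p r = 0.
Proof.
by rewrite /jac /jacobiator mbrpp mbr0r addr0 (mbr_asym r p) mbrNr subrr.
Qed.

Let jacC p q r : jac p q r = jac q r p. Proof. exact: jacobiator_cyc. Qed.

Let jac_der p q : is_der (jac p q).
Proof. by apply: jacobiator_der; [exact: mbrDr|exact: mbrMr|exact: mbr_asym]. Qed.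

Let jacXXX s t u : jac 'X_s 'X_t 'X_u = 0.
Proof.
have [->|st] := eqVneq s t; first exact: jac_diag.
have [->|tu] := eqVneq t u; first by rewrite jacC jac_diag.
have [->|su] := eqVneq s u; first by rewrite -jacC jac_diag.
exact: jacXXX_neq.
Qed.

Let jacCCC a b c : jac a%:MP b%:MP c%:MP = 0.
Proof. by rewrite /jac /jacobiator !mbrCC -!mpolyCD pbr_jacobi mpolyC0. Qed.

Lemma mbr_jacobi p q r : mbr p (mbr q r) + mbr q (mbr r p) + mbr r (mbr p q) = 0.
Proof.
rewrite -/(jacobiator mbr p q r) -/(jac p q r).
have jac1 a b p' : is_der (fun x => jac x a b) /\ is_der (jac a p').
  split; last exact: jac_der.
  by have [D M] := jac_der a b; split=> x y; rewrite !(jacC _ a b).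
have jac2 a b : is_der (fun x => jac a x b).
  by have [D M] := jac_der b a; split=> x y; rewrite -!(jacC b a).
move: p; apply: is_der_eq0 => [|c|s]; first by case: (jac1 q r q).
- move: q; apply: is_der_eq0 => [|c'|s]; first exact: jac2.
  + by move: r; apply: is_der_eq0.
  + by move: r; apply: is_der_eq0 => // c'; rewrite -jacC.
- move: q; apply: is_der_eq0 => [|c|t]; first exact: jac2.
  + by move: r; apply: is_der_eq0 => [||t]; rewrite // => *; rewrite jacC.
  + by move: r; apply: is_der_eq0 => // c; rewrite -jacC.
Qed.
End MpolyBracket.

(* [tg_mu i i] and [tg_gamma i i] are junk: no hypothesis constrains them and
   the algebra [tgwpa] below does not depend on them. *)
Record tgwpa_data (k : fieldType) (R : poissonAlgType k) (n : nat) :=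
    TgwpaData {
  tg_d : 'I_n -> R -> R;
  tg_a : 'I_n -> R;
  tg_mu : 'I_n -> 'I_n -> k;
  tg_gamma : 'I_n -> 'I_n -> k;
  tg_d_der : forall i, poisson_derivation (tg_d i);
  tg_d_comm : forall i j r, tg_d i (tg_d j r) = tg_d j (tg_d i r);
  tg_a_central : forall i, poisson_central (tg_a i);
  tg_a_regular : forall i, GRing.lreg (tg_a i);
  tg_d_a : forall i j, i != j -> tg_d j (tg_a i) = tg_gamma i j *: tg_a i;
  tg_gamma_mu : forall i j, i != j ->
    tg_gamma i j + tg_gamma j i = tg_mu i j + tg_mu j i
}.

Section TGWPA.
Variables (k : fieldType) (R : poissonAlgType k) (n : nat).
Variable D : tgwpa_data R n.
Local Notation P := {mpoly R[n + n]}.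
Local Notation d := (tg_d D).
Local Notation a := (tg_a D).
Local Notation mu := (tg_mu D).
Local Notation gamma := (tg_gamma D).

(* x_i is the variable of index [lshift n i] and y_i that of index [rshift n i]. *)
Local Notation xv i := ('X_(lshift n i) : P).
Local Notation yv i := ('X_(rshift n i) : P).

(* The brackets of the generators are {r, z_s} = tg_th s r *: z_s and
   {z_s, z_t} = tg_kap s t *: (z_s * z_t) + tg_e s t. *)
Definition tg_th (s : 'I_(n + n)) (r : R) : R :=
  match split s with inl i => d i r | inr i => - d i r end.

Definition tg_kap (s t : 'I_(n + n)) : k :=
  match split s, split t with
  | inl i, inl j => if i == j then 0 else gamma i j - mu i j
  | inr i, inl j => if i == j then 0 else mu i j
  | inl i, inr j => if i == j then 0 else - mu j i
  | inr i, inr j => if i == j then 0 else mu j i - gamma i j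
  end.

Definition tg_e (s t : 'I_(n + n)) : R :=
  match split s, split t with
  | inr i, inl j => if i == j then d i (a i) else 0
  | inl i, inr j => if i == j then - d i (a i) else 0
  | _, _ => 0
  end.

Local Notation br := (mbr tg_th tg_kap tg_e).

Let dD i r s : d i (r + s) = d i r + d i s.
Proof. by case: (tg_d_der D i) => l _ _; have := l 1 r s; rewrite !scale1r. Qed.
Let d0 i : d i 0 = 0.
Proof. by have := dD i 0 0; rewrite addr0 -[LHS]addr0 => /addrI. Qed.
Let dZ i (c : k) r : d i (c *: r) = c *: d i r.
Proof.
by case: (tg_d_der D i) => l _ _; have := l c r 0; rewrite d0 !addr0.
Qed.
Let dN i r : d i (- r) = - d i r.
Proof. by rewrite -scaleN1r dZ scaleN1r. Qed.

Fact tg_th_der s : poisson_derivation (tg_th s).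
Proof.
rewrite /poisson_derivation /tg_th; case: (split s) => i; case: (tg_d_der D i) => l M B.
  by split.
split=> [c r t|r t|r t]; first by rewrite l opprD scalerN.
  by rewrite M opprD mulNr mulrN.
by rewrite B opprD -!scaleN1r pbrZl pbrZr.
Qed.

Fact tg_th_comm s t r : tg_th s (tg_th t r) = tg_th t (tg_th s r).
Proof.
by rewrite /tg_th; case: (split s) => i; case: (split t) => j; rewrite ?dN tg_d_comm.
Qed.

Fact tg_kap_asym s t : tg_kap s t = - tg_kap t s.
Proof.
rewrite /tg_kap; case: (split s) => i; case: (split t) => j;
  rewrite [j == i]eq_sym; have [_|ij] := eqVneq i j; rewrite ?oppr0 ?opprK //.
all: have -> : gamma i j = mu i j + mu j i - gamma j i
  by rewrite -tg_gamma_mu // addrK.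
all: by ring.
Qed.

Fact tg_e_asym s t : tg_e s t = - tg_e t s.
Proof.
rewrite /tg_e; case: (split s) => i; case: (split t) => j;
  rewrite ?oppr0 // [j == i]eq_sym; have [->|_] := eqVneq i j;
  by rewrite ?oppr0 ?opprK.
Qed.

Fact tg_kap0 s : tg_kap s s = 0.
Proof. by rewrite /tg_kap; case: (split s) => i; rewrite eqxx. Qed.

Fact tg_e0 s : tg_e s s = 0.
Proof. by rewrite /tg_e; case: (split s). Qed.

Let da_central i : poisson_central (d i (a i)).
Proof.
move=> r; case: (tg_d_der D i) => _ _ B.
by have := B (a i) r; rewrite !tg_a_central d0 addr0 => <-.
Qed.

Fact tg_e_central s t : poisson_central (tg_e s t).
Proof.
move=> r; rewrite /tg_e; case: (split s) => i; case: (split t) => j;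
  try (case: eqP => _); rewrite -?scaleN1r ?pbrZl ?da_central ?scaler0 //.
all: by rewrite -[0 in LHS](scale0r 0) pbrZl scale0r.
Qed.

Fact tg_e_weight s t c : (tg_th s c + tg_th t c) * tg_e s t = 0.
Proof.
rewrite /tg_e /tg_th; case: (split s) => i; case: (split t) => j; rewrite ?mulr0 //.
all: have [->|_] := eqVneq i j; rewrite ?mulr0 //.
  by rewrite subrr mul0r.
by rewrite addNr mul0r.
Qed.

Let d_da i j : i != j -> d j (d i (a i)) = gamma i j *: d i (a i).
Proof. by move=> ij; rewrite tg_d_comm tg_d_a // dZ. Qed.

Fact tg_e_kap s t u : s != t -> s != u ->
  tg_th s (tg_e t u) = (tg_kap u s + tg_kap t s) *: tg_e t u.
Proof.
rewrite -[s]splitK -[t]splitK -[u]splitK /tg_th /tg_kap /tg_e !unsplitK.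
case: (split s) => l; case: (split t) => i; case: (split u) => j /=;
  rewrite ?scaler0 ?oppr0 ?d0 ?oppr0 //;
  have [<-{j}|ij] := eqVneq i j; rewrite ?scaler0 ?oppr0 ?d0 ?oppr0 // => si sj.
all: have il : i != l by apply/eqP => il; move: si sj; rewrite il eqxx.
all: rewrite ?dN d_da // (negPf il) ?scalerN ?opprK -?scaleNr; congr (_ *: _); by ring.
Qed.

Definition tg_rel (i : 'I_n) : P := yv i * xv i - (a i)%:MP.

Definition tg_ideal : {pred P} :=
  fun p => `[< exists c : 'I_n -> P, p = \sum_i c i * tg_rel i >].

Lemma tg_idealP p :
  reflect (exists c : 'I_n -> P, p = \sum_i c i * tg_rel i) (p \in tg_ideal).
Proof. exact: asboolP. Qed.

(* The evaluation x_i := a_i, y_i := 1 kills the ideal and fixes R. *)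
Let ev : P -> R :=
  meval (fun s : 'I_(n + n) => match split s with inl i => a i | inr _ => 1 end).

Let ev_ideal p : p \in tg_ideal -> ev p = 0.
Proof.
move=> /tg_idealP[c ->]; rewrite /ev raddf_sum big1 // => i _ /=.
rewrite mevalM mevalB mevalM mevalC !mevalXU.
rewrite -[lshift n i]/(unsplit (inl i)) -[rshift n i]/(unsplit (inr i)).
by rewrite !unsplitK mul1r subrr mulr0.
Qed.

Fact tg_ideal_closed : idealr_closed tg_ideal.
Proof.
split=> [||q p p' /tg_idealP[c ->] /tg_idealP[c' ->]].
- apply/tg_idealP; exists (fun=> 0).
  by rewrite big1 // => i _; rewrite mul0r.
- by apply/negP => /ev_ideal/eqP; rewrite /ev meval1 oner_eq0.
- apply/tg_idealP; exists (fun i => q * c i + c' i).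
  by rewrite mulr_sumr -big_split; apply: eq_bigr => i _; rewrite mulrDl mulrA.
Qed.

HB.instance Definition _ := isIdealr.Build P tg_ideal tg_ideal_closed.

(* A_mu(R, d, a) = R[x_1, y_1, .., x_n, y_n] / (y_1 x_1 - a_1, .., y_n x_n - a_n);
   its bracket [tg_br] is induced by [mbr], and takes the prescribed values on
   generators by lemmas [tg_emb_pmorph] and [tg_br_rx] to [tg_br_yy]. *)
Definition tgwpa : Type := {ideal_quot tg_ideal}.
HB.instance Definition _ := GRing.ComNzRing.on tgwpa.

Definition tg_pi (p : P) : tgwpa := (\pi_({ideal_quot tg_ideal}) p)%qT.

Fact tg_piD : {morph tg_pi : p q / p + q}.
Proof. by move=> p q; rewrite /tg_pi raddfD. Qed.
Fact tg_piN : {morph tg_pi : p / - p}.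
Proof. by move=> p; rewrite /tg_pi raddfN. Qed.
Fact tg_piM : {morph tg_pi : p q / p * q}.
Proof. by move=> p q; rewrite /tg_pi rmorphM. Qed.
Fact tg_pi1 : tg_pi 1 = 1.
Proof. by rewrite /tg_pi rmorph1. Qed.
Fact tg_piK u : tg_pi (repr (u : {ideal_quot tg_ideal})) = u.
Proof. exact: reprK. Qed.
Fact tg_pi_eq p q : reflect (tg_pi p = tg_pi q) (p - q \in tg_ideal).
Proof. by rewrite Quotient.idealrBE; apply: eqP. Qed.

Definition tg_scale (c : k) (u : tgwpa) : tgwpa := tg_pi (c%:A)%:MP * u.

Fact tg_scaleA b c u : tg_scale b (tg_scale c u) = tg_scale (b * c) u.
Proof. by rewrite /tg_scale mulrA -tg_piM -mpolyCM mulr_algl scalerA. Qed.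
Fact tg_scale1 : left_id 1 tg_scale.
Proof. by move=> u; rewrite /tg_scale scale1r mpolyC1 tg_pi1 mul1r. Qed.
Fact tg_scaleDr : right_distributive tg_scale +%R.
Proof. by move=> c u v; rewrite /tg_scale mulrDr. Qed.
Fact tg_scaleDl v : {morph tg_scale^~ v : b c / b + c}.
Proof. by move=> b c; rewrite /tg_scale scalerDl mpolyCD tg_piD mulrDl. Qed.
HB.instance Definition _ := GRing.Zmodule_isLmodule.Build k tgwpa
  tg_scaleA tg_scale1 tg_scaleDr tg_scaleDl.
Fact tg_scaleAl c (u v : tgwpa) : c *: (u * v) = c *: u * v.
Proof. exact: mulrA. Qed.
HB.instance Definition _ := GRing.Lmodule_isLalgebra.Build k tgwpa tg_scaleAl.
HB.instance Definition _ := GRing.Lalgebra_isComAlgebra.Build k tgwpa.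

Definition tg_emb (r : R) : tgwpa := tg_pi r%:MP.
Definition tg_x (i : 'I_n) : tgwpa := tg_pi (xv i).
Definition tg_y (i : 'I_n) : tgwpa := tg_pi (yv i).

Lemma tg_emb_inj : injective tg_emb.
Proof.
move=> r s /tg_pi_eq/ev_ideal/eqP.
by rewrite /ev mevalB !mevalC subr_eq0 => /eqP.
Qed.

Lemma tg_yx i : tg_y i * tg_x i = tg_emb (a i).
Proof.
rewrite -tg_piM; apply/tg_pi_eq/tg_idealP.
exists (fun j => (j == i)%:R); rewrite (bigD1 i) //= eqxx mul1r big1 ?addr0 //.
by move=> j /negPf->; rewrite mul0r.
Qed.

Let brD p q r : br p (q + r) = br p q + br p r.
Proof. by case: (mbr_der tg_kap tg_e tg_th_der p). Qed.
Let brM p q r : br p (q * r) = br p q * r + q * br p r.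
Proof. by case: (mbr_der tg_kap tg_e tg_th_der p). Qed.
Let br_asym p q : br p q = - br q p.
Proof. exact: (mbr_asym tg_th_der tg_kap_asym tg_e_asym). Qed.
Let brDl p q r : br (q + r) p = br q p + br r p.
Proof. by case: (mbr_derl tg_kap tg_e tg_th_der p). Qed.
Let brMl p q r : br (q * r) p = br q p * r + q * br r p.
Proof. by case: (mbr_derl tg_kap tg_e tg_th_der p). Qed.
Let br0 p : br p 0 = 0.
Proof. by have := brD p 0 0; rewrite addr0 -[LHS]addr0 => /addrI. Qed.
Let brN p q : br p (- q) = - br p q.
Proof. by apply/eqP; rewrite -addr_eq0 addrC -brD subrr br0. Qed.
Let brCC c c' : br c%:MP c'%:MP = {{c, c'}}%:MP.
Proof. exact: (mbrCC _ _ tg_th_der). Qed.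
Let brCX c s : br c%:MP 'X_s = tg_th s c *: 'X_s.
Proof. exact: (mbrCX _ _ tg_th_der). Qed.
Let brXX s t : br 'X_s 'X_t = mbr_var tg_kap tg_e s t.
Proof. exact: (mbrXX tg_th_der tg_kap_asym tg_e_asym). Qed.

Let thx i r : tg_th (lshift n i) r = d i r.
Proof. by rewrite /tg_th -[lshift n i]/(unsplit (inl i)) unsplitK. Qed.
Let thy i r : tg_th (rshift n i) r = - d i r.
Proof. by rewrite /tg_th -[rshift n i]/(unsplit (inr i)) unsplitK. Qed.

Let spl (i : 'I_n) : split (lshift n i) = inl i.
Proof. exact: (unsplitK (inl i)). Qed.
Let spr (i : 'I_n) : split (rshift n i) = inr i.
Proof. exact: (unsplitK (inr i)). Qed.

Let brxx i j : i != j -> br (xv i) (xv j) = (gamma i j - mu i j)%:A *: (xv i * xv j).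
Proof.
by move=> ij; rewrite brXX /mbr_var /tg_kap /tg_e !spl (negPf ij) mpolyC0 addr0.
Qed.
Let bryy i j : i != j -> br (yv i) (yv j) = (mu j i - gamma i j)%:A *: (yv i * yv j).
Proof.
by move=> ij; rewrite brXX /mbr_var /tg_kap /tg_e !spr (negPf ij) mpolyC0 addr0.
Qed.
Let bryx i j : i != j -> br (yv i) (xv j) = (mu i j)%:A *: (xv j * yv i).
Proof.
move=> ij; rewrite brXX /mbr_var /tg_kap /tg_e spl spr (negPf ij) mpolyC0 addr0.
by rewrite [yv i * _]mulrC.
Qed.
Let bryxi i : br (yv i) (xv i) = (d i (a i))%:MP.
Proof. by rewrite brXX /mbr_var /tg_kap /tg_e spl spr eqxx scale0r scale0r add0r. Qed.
Let brxxi i : br (xv i) (xv i) = 0.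
Proof. by rewrite brXX /mbr_var tg_kap0 tg_e0 scale0r scale0r mpolyC0 addr0. Qed.
Let bryyi i : br (yv i) (yv i) = 0.
Proof. by rewrite brXX /mbr_var tg_kap0 tg_e0 scale0r scale0r mpolyC0 addr0. Qed.

Let rel_ideal p i : p * tg_rel i \in tg_ideal.
Proof.
apply/tg_idealP; exists (fun j => if j == i then p else 0).
rewrite (bigD1 i) //= eqxx big1 ?addr0 //.
by move=> j /negPf->; rewrite mul0r.
Qed.

Fact br_rel p i : br p (tg_rel i) \in tg_ideal.
Proof.
rewrite /tg_rel; elim/mpoly_gen_ind: p => [c|s|p q Ip Iq|p q Ip Iq].
- rewrite brD brM brN !brCX brCC thx thy pbrC tg_a_central oppr0 mpolyC0 oppr0 addr0.
  suff -> : - d i c *: yv i * xv i + yv i * (d i c *: xv i) = 0 by exact: rpred0.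
  by rewrite scaleNr -scalerAr mulNr -scalerAl addNr.
- rewrite brD brM brN (br_asym _ (a i)%:MP) opprK brCX -[s]splitK.
  case: (split s) => j; rewrite /unsplit ?thx ?thy.
    have [->|ij] := eqVneq i j.
      rewrite brxxi mulr0 addr0 (br_asym (xv j)) bryxi -mul_mpolyC mulNr.
      by rewrite addNr rpred0.
    rewrite (br_asym (xv j)) bryx // (br_asym (xv j)) brxx //.
    rewrite tg_d_a // scalerBl -(mulr_algl (gamma i j) (a i)) -!mul_mpolyC mpolyCM mpolyCB.
    move: (rel_ideal (- ((gamma i j)%:A : R)%:MP * xv j) i); rewrite /tg_rel.
    move: (xv j) (xv i) (yv i) (a i)%:MP ((gamma i j)%:A : R)%:MP.
    move: ((mu i j)%:A : R)%:MP => m x z y f g.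
    by move=> h; apply: etrans h; congr in_mem; ring.
  have [->|ij] := eqVneq i j.
    rewrite bryyi mul0r add0r bryxi -mul_mpolyC mpolyCN mulNr mulrC subrr.
    exact: rpred0.
  rewrite (br_asym (yv j)) bryy // bryx 1?eq_sym //.
  rewrite tg_d_a // scalerBl -(mulr_algl (gamma i j) (a i)) -!mul_mpolyC mpolyCN mpolyCM mpolyCB.
  move: (rel_ideal (((gamma i j)%:A : R)%:MP * yv j) i); rewrite /tg_rel.
  move: (yv j) (xv i) (yv i) (a i)%:MP ((gamma i j)%:A : R)%:MP.
  move: ((mu j i)%:A : R)%:MP => m x z y f g.
  by move=> h; apply: etrans h; congr in_mem; ring.
- by rewrite brDl rpredD.
- rewrite brMl; apply: rpredD; last by apply: idealMr.
  by rewrite mulrC; apply: idealMr.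
Qed.

Fact br_ideal p q : q \in tg_ideal -> br p q \in tg_ideal.
Proof.
move=> /tg_idealP[c ->]; elim/big_rec: _ => [|i r _ Ir]; first by rewrite br0 rpred0.
rewrite brD brM; apply: rpredD => //; apply: rpredD; first exact: rel_ideal.
exact/idealMr/br_rel.
Qed.

Definition tg_br (u v : tgwpa) : tgwpa :=
  tg_pi (br (repr (u : {ideal_quot tg_ideal})) (repr (v : {ideal_quot tg_ideal}))).

Lemma tg_brE p q : tg_br (tg_pi p) (tg_pi q) = tg_pi (br p q).
Proof.
have tr p' q' q'' : tg_pi q' = tg_pi q'' -> tg_pi (br p' q') = tg_pi (br p' q'').
  by move=> /tg_pi_eq/(br_ideal p'); rewrite brD brN => /tg_pi_eq.
rewrite /tg_br (tr _ _ q (tg_piK _)) br_asym tg_piN (tr _ _ p (tg_piK _)).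
by rewrite -tg_piN -br_asym.
Qed.

Let tg_pi_ind (Q : tgwpa -> Prop) : (forall p, Q (tg_pi p)) -> forall u, Q u.
Proof. by move=> Qpi u; rewrite -[u]tg_piK. Qed.

Fact tg_brDr u v w : tg_br u (v + w) = tg_br u v + tg_br u w.
Proof.
elim/tg_pi_ind: u => p; elim/tg_pi_ind: v => q; elim/tg_pi_ind: w => r.
by rewrite -tg_piD !tg_brE brD tg_piD.
Qed.
Fact tg_brMr u v w : tg_br u (v * w) = tg_br u v * w + v * tg_br u w.
Proof.
elim/tg_pi_ind: u => p; elim/tg_pi_ind: v => q; elim/tg_pi_ind: w => r.
by rewrite -tg_piM !tg_brE brM tg_piD !tg_piM.
Qed.
Fact tg_br_asym u v : tg_br u v = - tg_br v u.
Proof.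
elim/tg_pi_ind: u => p; elim/tg_pi_ind: v => q.
by rewrite !tg_brE br_asym tg_piN.
Qed.
Fact tg_brr u : tg_br u u = 0.
Proof.
elim/tg_pi_ind: u => p; rewrite tg_brE.
rewrite (mbrpp tg_th_der tg_kap_asym tg_e_asym tg_kap0 tg_e0).
by rewrite /tg_pi raddf0.
Qed.
Fact tg_jacobi u v w :
  tg_br u (tg_br v w) + tg_br v (tg_br w u) + tg_br w (tg_br u v) = 0.
Proof.
elim/tg_pi_ind: u => p; elim/tg_pi_ind: v => q; elim/tg_pi_ind: w => r.
rewrite !tg_brE -!tg_piD.
rewrite (mbr_jacobi tg_th_der tg_th_comm tg_kap_asym tg_e_asym tg_kap0 tg_e0
  tg_e_central tg_e_weight tg_e_kap).
by rewrite /tg_pi raddf0.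
Qed.
Let tg_brA u c : tg_br u (tg_pi (c%:A : R)%:MP) = 0.
Proof.
elim/tg_pi_ind: u => p; rewrite tg_brE.
suff -> : br p (c%:A : R)%:MP = 0 by rewrite /tg_pi raddf0.
move: p; apply: is_der_eq0 => [|b|s]; first exact: (mbr_derl tg_kap tg_e tg_th_der).
  by rewrite brCC pbr_in_alg mpolyC0.
rewrite br_asym brCX; suff -> : tg_th s c%:A = 0 by rewrite scale0r oppr0.
have th1 : tg_th s 1 = 0.
  case: (tg_th_der s) => _ M _.
  by have := M 1 1; rewrite !mulr1 mul1r -[LHS]addr0 => /addrI.
have th0 : tg_th s 0 = 0 by rewrite /tg_th; case: (split s) => i; rewrite d0 ?oppr0.
by case: (tg_th_der s) => l _ _; have := l c 1 0; rewrite addr0 th1 th0 scaler0 addr0.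
Qed.
Fact tg_br_linearr u : linear (tg_br u).
Proof.
move=> c v w; rewrite tg_brDr; congr (_ + _).
by rewrite [LHS]tg_brMr tg_brA mul0r add0r.
Qed.
Fact tg_br_linearl v : linear (tg_br^~ v).
Proof.
by move=> c u w; rewrite tg_br_asym tg_br_linearr opprD -scalerN -!tg_br_asym.
Qed.

HB.instance Definition _ := isPoisson.Build k tgwpa
  tg_br_linearl tg_br_linearr tg_brr tg_jacobi tg_brMr.

Fact tg_emb_linear : linear tg_emb.
Proof.
move=> c r s; rewrite /tg_emb mpolyCD tg_piD; congr (_ + _).
by rewrite -(mulr_algl c r) mpolyCM tg_piM.
Qed.
Fact tg_emb_monoid : monoid_morphism tg_emb.
Proof. by split=> [|r s]; rewrite /tg_emb ?mpolyC1 ?tg_pi1 // mpolyCM tg_piM. Qed.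
Fact tg_emb_pmorph r s : tg_emb {{r, s}} = {{tg_emb r, tg_emb s}}.
Proof. by rewrite [RHS]tg_brE brCC. Qed.
HB.instance Definition _ := GRing.isLinear.Build k R tgwpa *:%R tg_emb tg_emb_linear.
HB.instance Definition _ := GRing.isMonoidMorphism.Build R tgwpa tg_emb tg_emb_monoid.
HB.instance Definition _ := isPoissonMorphism.Build k R tgwpa tg_emb tg_emb_pmorph.

Let tg_piZ c p : tg_pi ((c%:A : R) *: p) = c *: tg_pi p.
Proof. by rewrite -mul_mpolyC tg_piM. Qed.

Lemma tg_br_rx r i : {{tg_emb r, tg_x i}} = tg_emb (d i r) * tg_x i.
Proof. by rewrite [LHS]tg_brE brCX thx -mul_mpolyC tg_piM. Qed.
Lemma tg_br_ry r i : {{tg_emb r, tg_y i}} = - (tg_emb (d i r) * tg_y i).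
Proof.
by rewrite [LHS]tg_brE brCX thy -mul_mpolyC tg_piM mpolyCN tg_piN mulNr.
Qed.
Lemma tg_br_yx i : {{tg_y i, tg_x i}} = tg_emb (d i (a i)).
Proof. by rewrite [LHS]tg_brE bryxi. Qed.
Lemma tg_br_yxj i j : i != j -> {{tg_y i, tg_x j}} = mu i j *: (tg_x j * tg_y i).
Proof. by move=> ij; rewrite [LHS]tg_brE bryx // tg_piZ tg_piM. Qed.
Lemma tg_br_xx i j : i != j ->
  {{tg_x i, tg_x j}} = (gamma i j - mu i j) *: (tg_x i * tg_x j).
Proof. by move=> ij; rewrite [LHS]tg_brE brxx // tg_piZ tg_piM. Qed.
Lemma tg_br_yy i j : i != j ->
  {{tg_y i, tg_y j}} = (mu j i - gamma i j) *: (tg_y i * tg_y j).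
Proof. by move=> ij; rewrite [LHS]tg_brE bryy // tg_piZ tg_piM. Qed.

End TGWPA.

(* Main.v *)
(* A has a normal form: using y_i x_i = a_i, each element is uniquely an
   R-linear combination of reduced monomials, i.e. monomials in which x_i and y_i
   do not both occur; uniqueness holds because rewriting to normal form is an
   R-linear map on R[X] that kills the defining ideal.  As phi scales a reduced
   monomial by prod_i alpha_i^(u_i - v_i), an invariant element has coefficients
   with rho(c) = c / prod_i alpha_i^(u_i - v_i).  Iterating l times and using
   coprimality, m_i divides u_i and v_i for each i, and rho(c) = c.  Hence
   sending the generators of the TGWPA over R^<rho> to x_i^(m_i) and y_i^(m_i) is
   onto A^<phi>; it is injective because it commutes with normal forms. *)
Require Import Defs.
From HB Require Import structures.
From mathcomp Require Import all_boot all_algebra.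
From mathcomp Require Import boolp mpoly.
Set Implicit Arguments.
Unset Strict Implicit.
Unset Printing Implicit Defensive.
From mathcomp Require Import ssrcomplements ring zify.
Import GRing.Theory.
Local Open Scope ring_scope.

(** * Roots of unity of pairwise coprime orders *)

Lemma expr_coprime_eq1 (k : fieldType) (z : k) (p q : nat) :
  (0 < p)%N -> coprime p q -> z ^+ p = 1 -> z ^+ q = 1 -> z = 1.
Proof.
move=> p_gt0 pq zp zq; have [o ozr o_p] := prim_order_exists p_gt0 zp.
have := zq; rewrite -(expr0 z) => /eqP.
rewrite (eq_prim_root_expr ozr) mod0n => o_q.
have o1 : (o %| 1)%N by rewrite -(eqP pq) dvdn_gcd o_p.
by move: (prim_expr_order ozr); move: o1; rewrite dvdn1 => /eqP->; rewrite expr1.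
Qed.

(** Raising the product to the power l times all [m j] with j != i kills every factor except that of
    index i. The order of [z i] then divides both [m i] and an exponent coprime to it. *)
Lemma coprime_prod_eq1 (k : fieldType) (n l : nat) (m : 'I_n -> nat)
    (z : 'I_n -> k) :
  (forall i, 0 < m i)%N -> (forall i, coprime l (m i)) ->
  (forall i j, i != j -> coprime (m i) (m j)) ->
  (forall i, z i ^+ m i = 1) -> (\prod_i z i) ^+ l = 1 ->
  forall i, z i = 1.
Proof.
move=> m_gt0 lm mm zm zl i.
pose K := (l * \prod_(j | j != i) m j)%N.
have K1 : coprime (m i) K.
  rewrite coprimeMr coprime_sym lm /=.
  by elim/big_ind: _ => [|x y cx cy|j ji]; rewrite ?coprimen1 ?coprimeMr ?cx // mm // eq_sym.
apply: (expr_coprime_eq1 (m_gt0 i) K1 (zm i)).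
have: (\prod_j z j) ^+ K = 1 by rewrite exprM zl expr1n.
rewrite (bigD1 i) //= exprMn -prodrXl big1 ?mulr1 // => j ji.
by rewrite /K (bigD1 j) //= mulnCA exprM zm expr1n.
Qed.

(** * Inverses of Poisson isomorphisms, and brackets of powers *)

Lemma poisson_iso_sym (k : fieldType) (A B : poissonAlgType k) :
  poisson_iso A B -> poisson_iso B A.
Proof.
case=> f [g fK gK].
have gL : linear g.
  by move=> c u v; apply: (can_inj fK); rewrite linearD linearZ /= !gK.
have gM : monoid_morphism g.
  by split=> [|u v]; apply: (can_inj fK); rewrite ?rmorph1 ?rmorphM /= !gK.
have gB u v : g {{u, v}} = {{g u, g v}}.
  by apply: (can_inj fK); rewrite pmorph !gK.
pose h : {poisson B -> A} := HB.pack g (GRing.isLinear.Build k B A *:%R g gL)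
  (GRing.isMonoidMorphism.Build B A g gM) (isPoissonMorphism.Build k B A g gB).
by exists h; exists f.
Qed.

Section PoissonPowers.
Variables (k : fieldType) (A : poissonAlgType k).
Implicit Types u v : A.

(** The exponent is a successor so that lowering it needs no truncated subtraction; a positive [m i]
    is later put in this form by [prednK]. *)
Lemma pbrXr u v p : {{u, v ^+ p.+1}} = p.+1%:R *: (v ^+ p * {{u, v}}).
Proof.
elim: p => [|p IHp]; first by rewrite expr1 expr0 mul1r scale1r.
rewrite exprS pbrMr IHp -scalerAr mulrA -exprS mulrC -[X in X + _]scale1r -scalerDl.
by rewrite -mulrS.
Qed.

Lemma pbrXl u v p : {{u ^+ p.+1, v}} = p.+1%:R *: (u ^+ p * {{u, v}}).
Proof. by rewrite pbrC pbrXr -scalerN -mulrN -pbrC. Qed.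

Lemma pbrX2 u v w p q : {{u, v}} = w ->
  {{u ^+ p.+1, v ^+ q.+1}} = (p.+1 * q.+1)%:R *: (u ^+ p * v ^+ q * w).
Proof. by move=> <-; rewrite pbrXl pbrXr -scalerAr scalerA -natrM mulrA. Qed.

(** Log-canonical brackets stay log-canonical on powers. This produces the factors [m i * m j] in
    the brackets of the new generators. *)
Lemma pbrX_eigen u v p q (c : k) : {{u, v}} = c *: (u * v) ->
  {{u ^+ p, v ^+ q}} = ((p * q)%:R * c) *: (u ^+ p * v ^+ q).
Proof.
move=> uv; case: p => [|p].
  by rewrite mul0n mul0r scale0r expr0 pbrC -[1]scale1r pbr_in_alg oppr0.
case: q => [|q].
  by rewrite muln0 mul0r scale0r expr0 -[1]scale1r pbr_in_alg.
by rewrite (pbrX2 _ _ uv) -scalerAr scalerA !exprSr mulrACA.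
Qed.

Lemma poisson_derivationX (d : A -> A) u p : poisson_derivation d ->
  d (u ^+ p.+1) = p.+1%:R *: (u ^+ p * d u).
Proof.
case=> _ dM _; elim: p => [|p IHp]; first by rewrite expr1 expr0 mul1r scale1r.
rewrite exprS dM IHp -scalerAr mulrA -exprS mulrC -[X in X + _]scale1r -scalerDl.
by rewrite -mulrS.
Qed.
End PoissonPowers.

(** * Universal property of a TGWPA *)

Section TgwpaMorphisms.
Variables (k : fieldType) (R : poissonAlgType k) (n : nat) (D : tgwpa_data R n).
Local Notation P := {mpoly R[n + n]}.
Local Notation d := (tg_d D).
Local Notation a := (tg_a D).

HB.instance Definition _ := GRing.isZmodMorphism.Build P (tgwpa D) (tg_pi D)
  (fun p q => etrans (tg_piD D p (- q)) (congr1 (+%R _) (tg_piN D q))).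
HB.instance Definition _ := GRing.isMonoidMorphism.Build P (tgwpa D) (tg_pi D)
  (conj (tg_pi1 D) (tg_piM D)).

Lemma tg_pi_scale r p : tg_pi D (r *: p) = tg_emb D r * tg_pi D p.
Proof. by rewrite -mul_mpolyC rmorphM. Qed.

Lemma tg_pi_ind (Q : tgwpa D -> Prop) :
  (forall p, Q (tg_pi D p)) -> forall u, Q u.
Proof. by move=> Qpi u; rewrite -[u]tg_piK. Qed.

Lemma tg_gen_ind (Q : tgwpa D -> Prop) :
  (forall r, Q (tg_emb D r)) -> (forall i, Q (tg_x D i)) ->
  (forall i, Q (tg_y D i)) -> (forall u v, Q u -> Q v -> Q (u + v)) ->
  (forall u v, Q u -> Q v -> Q (u * v)) -> forall u, Q u.
Proof.
move=> Qr Qx Qy QD QM; elim/tg_pi_ind; elim/mpoly_gen_ind => [r|s|p q Qp Qq|p q Qp Qq].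
- exact: Qr.
- by rewrite -[s]splitK; case: (split s) => i; [exact: Qx|exact: Qy].
- by rewrite rmorphD; apply: QD.
- by rewrite rmorphM; apply: QM.
Qed.

(** Multiplying by y_i turns x_i into a_i, which cancels in R by regularity. *)
Lemma tg_emb_x_inj i r s :
  tg_emb D r * tg_x D i = tg_emb D s * tg_x D i -> r = s.
Proof.
move/(congr1 ( *%R (tg_y D i))); rewrite !(mulrCA (tg_y D i)) tg_yx -!rmorphM => /tg_emb_inj.
by rewrite ![_ * a i]mulrC; apply: tg_a_regular.
Qed.

Section Lift.
Variables (B : poissonAlgType k) (f : {poisson R -> B}) (X Y : 'I_n -> B).

Definition tg_lift_poly : P -> B :=
  mmap f (fun s => match split s with inl i => X i | inr i => Y i end).
HB.instance Definition _ := GRing.RMorphism.on tg_lift_poly.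
(** Evaluating at a chosen representative makes the map available before any relation is checked;
    independence of the choice rests on [YX] and is [tg_lift_pi]. *)
Definition tg_lift (u : tgwpa D) : B := tg_lift_poly (repr (u : {ideal_quot tg_ideal D})).

Hypothesis YX : forall i, Y i * X i = f (a i).

Lemma tg_lift_polyC r : tg_lift_poly r%:MP = f r.
Proof. exact: mmapC. Qed.
Lemma tg_lift_polyx i : tg_lift_poly 'X_(lshift n i) = X i.
Proof. by rewrite /tg_lift_poly mmapX mmap1U (unsplitK (inl i)). Qed.
Lemma tg_lift_polyy i : tg_lift_poly 'X_(rshift n i) = Y i.
Proof. by rewrite /tg_lift_poly mmapX mmap1U (unsplitK (inr i)). Qed.

(** Two representatives of a class differ by a combination of the elements [tg_rel D i], and these
    evaluate to 0 by [YX]. *)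
Lemma tg_lift_pi p : tg_lift (tg_pi D p) = tg_lift_poly p.
Proof.
apply/eqP; rewrite -subr_eq0 -rmorphB /=; apply/eqP.
have /tg_pi_eq/tg_idealP[c ->] := tg_piK (tg_pi D p).
rewrite rmorph_sum big1 // => i _.
by rewrite rmorphM /= /tg_rel rmorphB rmorphM /= tg_lift_polyC tg_lift_polyx
  tg_lift_polyy YX subrr mulr0.
Qed.

Lemma tg_lift_emb r : tg_lift (tg_emb D r) = f r.
Proof. by rewrite tg_lift_pi tg_lift_polyC. Qed.
Lemma tg_lift_x i : tg_lift (tg_x D i) = X i.
Proof. by rewrite tg_lift_pi tg_lift_polyx. Qed.
Lemma tg_lift_y i : tg_lift (tg_y D i) = Y i.
Proof. by rewrite tg_lift_pi tg_lift_polyy. Qed.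

Lemma tg_liftD : {morph tg_lift : u v / u + v}.
Proof.
elim/tg_pi_ind => p; elim/tg_pi_ind => q.
by rewrite -rmorphD !tg_lift_pi -rmorphD.
Qed.
Lemma tg_liftM : {morph tg_lift : u v / u * v}.
Proof.
elim/tg_pi_ind => p; elim/tg_pi_ind => q.
by rewrite -rmorphM !tg_lift_pi -rmorphM.
Qed.
Lemma tg_lift1 : tg_lift 1 = 1.
Proof. by rewrite -(rmorph1 (tg_emb D)) tg_lift_emb rmorph1. Qed.
Lemma tg_lift_linear : linear tg_lift.
Proof.
move=> c u v; rewrite tg_liftD -[c *: u]mulr_algl tg_liftM.
by rewrite -(rmorph_alg (tg_emb D)) tg_lift_emb rmorph_alg mulr_algl.
Qed.

Hypothesis br_rX : forall r i, {{f r, X i}} = f (d i r) * X i.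
Hypothesis br_rY : forall r i, {{f r, Y i}} = - (f (d i r) * Y i).
Hypothesis br_YX : forall i, {{Y i, X i}} = f (d i (a i)).
Hypothesis br_YXj : forall i j, i != j ->
  {{Y i, X j}} = tg_mu D i j *: (X j * Y i).
Hypothesis br_XX : forall i j, i != j ->
  {{X i, X j}} = (tg_gamma D i j - tg_mu D i j) *: (X i * X j).
Hypothesis br_YY : forall i j, i != j ->
  {{Y i, Y j}} = (tg_mu D j i - tg_gamma D i j) *: (Y i * Y j).

(** With one argument fixed, both sides are derivations along [tg_lift] in the other. Hence it is
    enough to compare them on pairs of generators, where the hypotheses apply. *)
Lemma tg_lift_br u v : tg_lift {{u, v}} = {{tg_lift u, tg_lift v}}.
Proof.
have lN w : tg_lift (- w) = - tg_lift w.
  have l0 : tg_lift 0 = 0 by rewrite -(rmorph0 (tg_emb D)) tg_lift_emb rmorph0.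
  by apply/eqP; rewrite -addr_eq0 -tg_liftD addNr l0.
have lZ c w : tg_lift (c *: w) = c *: tg_lift w.
  by have := tg_lift_linear c w 0; rewrite addr0 -[0 in X in X -> _](subrr w)
    tg_liftD lN subrr addr0.
(* By antisymmetry each pair of generators needs checking in one order only. *)
have lC w w' : tg_lift {{w, w'}} = {{tg_lift w, tg_lift w'}} ->
    tg_lift {{w', w}} = {{tg_lift w', tg_lift w}}.
  by move=> e; rewrite pbrC lN e -pbrC.
have DM w : (forall r, tg_lift {{w, tg_emb D r}} = {{tg_lift w, tg_lift (tg_emb D r)}}) ->
    (forall i, tg_lift {{w, tg_x D i}} = {{tg_lift w, tg_lift (tg_x D i)}}) ->
    (forall i, tg_lift {{w, tg_y D i}} = {{tg_lift w, tg_lift (tg_y D i)}}) ->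
    forall w', tg_lift {{w, w'}} = {{tg_lift w, tg_lift w'}}.
  move=> Er Ex Ey; elim/tg_gen_ind => // [w1 w2 E1 E2|w1 w2 E1 E2].
    by rewrite pbrDr !tg_liftD E1 E2 pbrDr.
  by rewrite pbrMr tg_liftD !tg_liftM E1 E2 pbrMr.
have rx r i : tg_lift {{tg_emb D r, tg_x D i}} =
    {{tg_lift (tg_emb D r), tg_lift (tg_x D i)}}.
  by rewrite tg_br_rx tg_liftM !tg_lift_emb tg_lift_x br_rX.
have ry r i : tg_lift {{tg_emb D r, tg_y D i}} =
    {{tg_lift (tg_emb D r), tg_lift (tg_y D i)}}.
  by rewrite tg_br_ry lN tg_liftM !tg_lift_emb tg_lift_y br_rY.
have yx i j : tg_lift {{tg_y D i, tg_x D j}} =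
    {{tg_lift (tg_y D i), tg_lift (tg_x D j)}}.
  have [<-|ij] := eqVneq i j.
    by rewrite tg_br_yx tg_lift_emb tg_lift_x tg_lift_y br_YX.
  by rewrite tg_br_yxj // lZ tg_liftM tg_lift_x tg_lift_y br_YXj.
move: v; apply: (DM) => [r|j|j].
- apply: (lC); move: u; apply: (DM) => [s|i|i] //.
  by rewrite -tg_emb_pmorph !tg_lift_emb pmorph.
- apply: (lC); move: u; apply: (DM) => [r|i|i]; try exact: (lC).
  have [<-|ij] := eqVneq j i; first by rewrite !pbrrr -[0]subr0 tg_liftD lN subrr.
  by rewrite tg_br_xx // lZ tg_liftM !tg_lift_x br_XX.
- apply: (lC); move: u; apply: (DM) => [r|i|i] //; first exact: (lC).
  have [<-|ij] := eqVneq j i; first by rewrite !pbrrr -[0]subr0 tg_liftD lN subrr.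
  by rewrite tg_br_yy // lZ tg_liftM !tg_lift_y br_YY.
Qed.

Lemma tg_lift_poisson : exists g : {poisson tgwpa D -> B}, g =1 tg_lift.
Proof.
pose g : {poisson tgwpa D -> B} := HB.pack tg_lift
  (GRing.isLinear.Build k (tgwpa D) B *:%R tg_lift tg_lift_linear)
  (GRing.isMonoidMorphism.Build (tgwpa D) B tg_lift (conj tg_lift1 tg_liftM))
  (isPoissonMorphism.Build k (tgwpa D) B tg_lift tg_lift_br).
by exists g.
Qed.
End Lift.
End TgwpaMorphisms.

(** * Linear maps on polynomials prescribed on monomials *)

Section MonomialwiseExtension.
Variables (N : nat) (R : comNzRingType) (V : lmodType R) (F : 'X_{1..N} -> V).
Local Notation P := {mpoly R[N]}.

Definition mlin (p : P) : V := \sum_(m <- msupp p) p@_m *: F m.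

(** Summing over a fixed finite set instead of the support lets the sums of different polynomials be
    added term by term. *)
Lemma mlinwE i p : (msize p <= i)%N ->
  mlin p = \sum_(m : 'X_{1..N < i}) p@_m *: F m.
Proof.
move=> le_pi; set I : subFinType _ := 'X_{1..N < i}.
rewrite /mlin (big_mksub I) ?msupp_uniq //=; last first.
  by move=> m /msize_mdeg_lt/leq_trans; apply.
by rewrite big_rmcond //= => m /memN_msupp_eq0->; rewrite scale0r.
Qed.

Lemma mlin_is_linear : linear mlin.
Proof.
move=> c p q; pose i := maxn (msize (c *: p + q)) (maxn (msize p) (msize q)).
rewrite !(@mlinwE i) ?leq_max ?leqnn ?orbT // scaler_sumr -big_split /=.
by apply: eq_bigr => m _; rewrite mcoeffD mcoeffZ scalerDl scalerA.
Qed.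
HB.instance Definition _ := GRing.isLinear.Build R P V *:%R mlin mlin_is_linear.

Lemma mlinX m : mlin 'X_[m] = F m.
Proof. by rewrite /mlin msuppX big_seq1 mcoeffX eqxx scale1r. Qed.
End MonomialwiseExtension.

(** * Normal forms modulo the relations y_i x_i = a_i *)

Section NormalForm.
Variables (k : fieldType) (R : poissonAlgType k) (n : nat) (D : tgwpa_data R n).
Local Notation P := {mpoly R[n + n]}.
Local Notation a := (tg_a D).
Implicit Types (m : 'X_{1..n + n}) (p : P).

Definition tg_ix (s : 'I_(n + n)) : 'I_n :=
  match split s with inl i => i | inr i => i end.

Lemma tg_ixl i : tg_ix (lshift n i) = i.
Proof. by rewrite /tg_ix (unsplitK (inl i)). Qed.
Lemma tg_ixr i : tg_ix (rshift n i) = i.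
Proof. by rewrite /tg_ix (unsplitK (inr i)). Qed.

(* The exponent of y_i x_i in the monomial, to be rewritten to a power of a_i. *)
Definition mnm_cap m (i : 'I_n) : nat := minn (m (lshift n i)) (m (rshift n i)).
Definition mnm_red m : 'X_{1..n + n} :=
  [multinom (m s - mnm_cap m (tg_ix s))%N | s < n + n].

Lemma mnm_cap_red m i : mnm_cap (mnm_red m) i = 0%N.
Proof. by rewrite /mnm_cap !mnmE tg_ixl tg_ixr /mnm_cap; lia. Qed.

Lemma mnm_red_id m : (forall i, mnm_cap m i = 0%N) -> mnm_red m = m.
Proof. by move=> m0; apply/mnmP => s; rewrite mnmE m0 subn0. Qed.

Definition tg_nf : P -> P :=
  mlin (fun m => (\prod_i a i ^+ mnm_cap m i) *: 'X_[mnm_red m]).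
HB.instance Definition _ := GRing.Linear.on tg_nf.

Lemma tg_nfX m : tg_nf 'X_[m] = (\prod_i a i ^+ mnm_cap m i) *: 'X_[mnm_red m].
Proof. exact: mlinX. Qed.

(** Multiplying a monomial by y_i x_i raises its cap at i by one and leaves its reduced part
    unchanged, so the normal form is just multiplied by a_i. *)
Lemma tg_nf_rel p i : tg_nf (p * tg_rel D i) = 0.
Proof.
elim/mpolyind: p => [|c m p _ _ IHp]; first by rewrite mul0r linear0.
rewrite mulrDl linearD /= IHp addr0 -scalerAl linearZ /=.
rewrite mulrBr linearB /= -!mpolyXD [_ * (a i)%:MP]mulrC mul_mpolyC linearZ /=.
rewrite !tg_nfX; set m' := (m + _)%MM.
have m'l j : m' (lshift n j) = (m (lshift n j) + (j == i))%N.
  by rewrite !mnmDE !mnm1E eq_rlshift eq_lshift eq_sym.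
have m'r j : m' (rshift n j) = (m (rshift n j) + (j == i))%N.
  by rewrite !mnmDE !mnm1E eq_lrshift eq_rshift addn0 eq_sym.
have cap' j : mnm_cap m' j = (mnm_cap m j + (j == i))%N.
  by rewrite /mnm_cap m'l m'r addn_minl.
have -> : mnm_red m' = mnm_red m.
  apply/mnmP => s; rewrite [LHS]mnmE [RHS]mnmE cap' -[s]splitK; case: (split s) => j /=.
    by rewrite m'l tg_ixl subnDr.
  by rewrite m'r tg_ixr subnDr.
suff -> : \prod_j a j ^+ mnm_cap m' j = a i * \prod_j a j ^+ mnm_cap m j.
  by rewrite -scalerA subrr scaler0.
rewrite (bigD1 i) //= [in RHS](bigD1 i) //= cap' eqxx addn1 exprS -mulrA.
by congr (_ * (_ * _)); apply: eq_bigr => j /negPf ji; rewrite cap' ji addn0.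
Qed.

(** In the quotient a_i^c equals (y_i x_i)^c, which restores the exponents removed by [mnm_red]. *)
Lemma tg_pi_nf p : tg_pi D (tg_nf p) = tg_pi D p.
Proof.
elim/mpolyind: p => [|c m p _ _ IHp]; first by rewrite linear0.
rewrite linearD linearZ /= !rmorphD /= IHp tg_nfX !tg_pi_scale; congr (_ * _ + _).
rewrite rmorph_prod !mpolyXE_id !rmorph_prod !big_split_ord /= -!big_split /=.
apply: eq_bigr => i _; rewrite !mnmE tg_ixl tg_ixr !rmorphXn /=.
rewrite -[tg_pi D 'X_(lshift n i)]/(tg_x D i) -[tg_pi D 'X_(rshift n i)]/(tg_y D i).
rewrite -tg_yx [tg_y D i * _]mulrC exprMn mulrACA -!exprD.
by rewrite !subnKC // /mnm_cap ?geq_minl ?geq_minr.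
Qed.

(** Normal forms detect the ideal: [tg_nf] kills it and preserves classes. *)
Lemma tg_pi_eq0P p : (tg_pi D p = 0) <-> (tg_nf p = 0).
Proof.
split=> [|p0]; last by rewrite -tg_pi_nf p0 rmorph0.
rewrite -(rmorph0 (tg_pi D)) => /tg_pi_eq; rewrite subr0 => /tg_idealP[c ->].
by rewrite linear_sum big1 // => i _; exact: tg_nf_rel.
Qed.

Lemma tg_nf_id p : (forall m, p@_m != 0 -> mnm_red m = m) -> tg_nf p = p.
Proof.
move=> red; rewrite [RHS]mpolyE /tg_nf /mlin; apply: eq_big_seq => m.
rewrite mcoeff_msupp => /red redm.
by rewrite redm big1 ?scale1r // => i _; rewrite -redm mnm_cap_red.
Qed.

Lemma mcoeff_nf p m : (tg_nf p)@_m != 0 -> mnm_red m = m.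
Proof.
apply: contra_neq_eq => redm; rewrite /tg_nf /mlin raddf_sum big1 // => m' _ /=.
rewrite !mcoeffZ mcoeffX; case: eqP => [m'm|_]; last by rewrite !mulr0.
by case/eqP: redm; rewrite -m'm mnm_red_id // => i; exact: mnm_cap_red.
Qed.
End NormalForm.

(** * Scaling of exponents *)

Section MonomialScaling.
Variables (n : nat) (w : 'I_n -> nat).
Hypothesis w_gt0 : forall i, (0 < w i)%N.
Implicit Types m : 'X_{1..n + n}.

(** The effect on exponents of substituting x_i^(w i) and y_i^(w i) for x_i and y_i. *)
Definition mnm_scale m : 'X_{1..n + n} := [multinom (w (tg_ix s) * m s)%N | s < n + n].

Lemma mnm_scale_inj : injective mnm_scale.
Proof.
move=> m m' mm; apply/mnmP => s; have /mnmP/(_ s)/eqP := mm.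
by rewrite !mnmE eqn_pmul2l // => /eqP.
Qed.

Lemma mnm_cap_scale m i : mnm_cap (mnm_scale m) i = (w i * mnm_cap m i)%N.
Proof. by rewrite /mnm_cap !mnmE tg_ixl tg_ixr minnMr. Qed.

Lemma mnm_red_scale m : mnm_red (mnm_scale m) = mnm_scale (mnm_red m).
Proof. by apply/mnmP => s; rewrite !mnmE mnm_cap_scale mulnBr. Qed.
(** In a reduced monomial x_i or y_i has exponent 0, so the congruence makes the other exponent
    divisible by [w i]. *)
Lemma mnm_scale_dvd m : mnm_red m = m ->
  (forall i, m (lshift n i) = m (rshift n i) %[mod w i]) ->
  exists m', mnm_scale m' = m.
Proof.
move=> redm mw; exists [multinom (m s %/ w (tg_ix s))%N | s < n + n].
apply/mnmP => s; rewrite !mnmE mulnC divnK //.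
have := mw (tg_ix s).
have : mnm_cap m (tg_ix s) = 0%N by rewrite -redm mnm_cap_red.
rewrite /mnm_cap -[s]splitK; case: (split s) => i /=; rewrite ?tg_ixl ?tg_ixr => cap0.
  have [->|gt0] := posnP (m (rshift n i)); first by rewrite mod0n => /eqP.
  by have -> : m (lshift n i) = 0%N by lia.
have [->|gt0] := posnP (m (lshift n i)); first by rewrite mod0n => /esym/eqP.
by have -> : m (rshift n i) = 0%N by lia.
Qed.
End MonomialScaling.

(** * The TGWPA over the fixed ring and its map to the invariants *)

Section InvariantData.
Variables (k : fieldType) (n : nat) (R : poissonAlgType k) (D : tgwpa_data R n).
Variables (phi : {poisson tgwpa D -> tgwpa D}) (rho : {poisson R -> R}).
Hypothesis phi_rho : forall r : R, phi (tg_emb D r) = tg_emb D (rho r).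
Variables (alpha : 'I_n -> k) (m : 'I_n -> nat).
Hypothesis phi_x : forall i, phi (tg_x D i) = alpha i *: tg_x D i.
Hypothesis phi_y : forall i, phi (tg_y D i) = (alpha i)^-1 *: tg_y D i.
Hypothesis alpha_neq0 : forall i, alpha i != 0.
Hypothesis alpha_m : forall i, alpha i ^+ m i = 1.
Hypothesis m_gt0 : forall i, (0 < m i)%N.
Local Notation d := (tg_d D).
Local Notation a := (tg_a D).

(** The scalars on x_i and y_i are mutually inverse, so [phi] fixes their product. *)
Lemma rho_a i : rho (a i) = a i.
Proof.
apply: (@tg_emb_inj _ _ _ D); rewrite -phi_rho -tg_yx rmorphM /= phi_x phi_y.
by rewrite -scalerAl -scalerAr scalerA mulVf // scale1r.
Qed.

(** Apply [phi] to {r, x_i} = d_i(r) x_i and cancel [alpha i] and x_i. *)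
Lemma rho_d i r : rho (d i r) = d i (rho r).
Proof.
have := pmorph (s := phi) (tg_emb D r) (tg_x D i).
rewrite tg_br_rx rmorphM /= !phi_rho phi_x pbrZr tg_br_rx -scalerAr.
by move/(scalerI (alpha_neq0 i))/tg_emb_x_inj.
Qed.

Fact fixed_d_subproof i (r : fixed rho) : d i (val r) *+ m i \in fixed_pred rho.
Proof. by rewrite inE rmorphMn /= rho_d (eqP (valP r)). Qed.
Definition fixed_d i (r : fixed rho) : fixed rho := Fixed (fixed_d_subproof i r).

Fact fixed_a_subproof i : a i ^+ m i \in fixed_pred rho.
Proof. by rewrite inE rmorphXn /= rho_a. Qed.
Definition fixed_a i : fixed rho := Fixed (fixed_a_subproof i).

Let d_lin i : linear (d i). Proof. by case: (tg_d_der D i). Qed.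
Let dMn i r j : d i (r *+ j) = d i r *+ j.
Proof.
pose f : {linear R -> R} := HB.pack (d i) (GRing.isLinear.Build k R R *:%R (d i) (d_lin i)).
exact: (raddfMn f).
Qed.

Lemma fixed_d_der i : poisson_derivation (fixed_d i).
Proof.
have [dL dM dB] := tg_d_der D i; split=> [c r s|r s|r s]; apply: val_inj => /=.
- by rewrite dL mulrnDl scalerMnr.
- by rewrite dM mulrnDl mulrnAl mulrnAr.
- by rewrite dB mulrnDl -!scaler_nat pbrZl pbrZr.
Qed.

Lemma fixed_d_comm i j r : fixed_d i (fixed_d j r) = fixed_d j (fixed_d i r).
Proof. by apply: val_inj; rewrite /= !dMn tg_d_comm mulrnAC. Qed.

Lemma fixed_a_central i : poisson_central (fixed_a i).
Proof.
move=> r; apply: val_inj; rewrite /= -(prednK (m_gt0 i)) pbrXl tg_a_central.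
by rewrite mulr0 scaler0.
Qed.

Lemma fixed_a_regular i : GRing.lreg (fixed_a i).
Proof.
move=> r s /(congr1 val) /= rs; apply: val_inj.
exact: (@lregX _ _ (m i) (@tg_a_regular _ _ _ D i) _ _ rs).
Qed.

Lemma d_aX i p : d i (a i ^+ p.+1) = p.+1%:R *: (a i ^+ p * d i (a i)).
Proof. exact: poisson_derivationX (tg_d_der D i). Qed.

(** The factor [m i] comes from differentiating the power of a_i, the factor [m j] from the multiple
    of d_j. *)
Lemma fixed_d_a i j : i != j ->
  fixed_d j (fixed_a i) = ((m i * m j)%:R * tg_gamma D i j) *: fixed_a i.
Proof.
move=> ij; apply: val_inj => /=.
rewrite -(prednK (m_gt0 i)) (poisson_derivationX _ _ (tg_d_der D j)) tg_d_a //.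
rewrite -scalerAr -exprSr scalerA -scaler_nat scalerA natrM; congr (_ *: _).
by rewrite mulrA [_ * (m j)%:R]mulrC.
Qed.

Lemma fixed_gamma_mu i j : i != j ->
  (m i * m j)%:R * tg_gamma D i j + (m j * m i)%:R * tg_gamma D j i =
  (m i * m j)%:R * tg_mu D i j + (m j * m i)%:R * tg_mu D j i.
Proof. by move=> ij; rewrite [(m j * m i)%N]mulnC -!mulrDr tg_gamma_mu. Qed.

Definition fixed_data : tgwpa_data (fixed rho) n :=
  @TgwpaData k (fixed rho) n fixed_d fixed_a
    (fun i j => (m i * m j)%:R * tg_mu D i j)
    (fun i j => (m i * m j)%:R * tg_gamma D i j)
    fixed_d_der fixed_d_comm fixed_a_central fixed_a_regular fixed_d_a
    fixed_gamma_mu.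

Fact fixed_emb_subproof (r : fixed rho) : tg_emb D (val r) \in fixed_pred phi.
Proof. by rewrite inE phi_rho (eqP (valP r)). Qed.
Definition fixed_emb (r : fixed rho) : fixed phi := Fixed (fixed_emb_subproof r).

Fact fixed_emb_linear : linear fixed_emb.
Proof. by move=> c r s; apply: val_inj; rewrite /= linearD linearZ. Qed.
Fact fixed_emb_monoid : monoid_morphism fixed_emb.
Proof. by split=> [|r s]; apply: val_inj; rewrite /= ?rmorph1 ?rmorphM. Qed.
Fact fixed_emb_pmorph r s : fixed_emb {{r, s}} = {{fixed_emb r, fixed_emb s}}.
Proof. by apply: val_inj; rewrite /= tg_emb_pmorph. Qed.
HB.instance Definition _ :=
  GRing.isLinear.Build k (fixed rho) (fixed phi) *:%R fixed_emb fixed_emb_linear.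
HB.instance Definition _ :=
  GRing.isMonoidMorphism.Build (fixed rho) (fixed phi) fixed_emb fixed_emb_monoid.
HB.instance Definition _ :=
  isPoissonMorphism.Build k (fixed rho) (fixed phi) fixed_emb fixed_emb_pmorph.

Fact fixed_x_subproof i : tg_x D i ^+ m i \in fixed_pred phi.
Proof. by rewrite inE rmorphXn /= phi_x exprZn alpha_m scale1r. Qed.
Definition fixed_x i : fixed phi := Fixed (fixed_x_subproof i).

Fact fixed_y_subproof i : tg_y D i ^+ m i \in fixed_pred phi.
Proof. by rewrite inE rmorphXn /= phi_y exprZn exprVn alpha_m invr1 scale1r. Qed.
Definition fixed_y i : fixed phi := Fixed (fixed_y_subproof i).

Lemma fixed_yx i : fixed_y i * fixed_x i = fixed_emb (fixed_a i).
Proof. by apply: val_inj; rewrite /= -exprMn tg_yx rmorphXn. Qed.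

Let fixed_valX (r : fixed rho) j : fixed_val (r ^+ j) = fixed_val r ^+ j.
Proof. exact: (rmorphXn (val : fixed rho -> R)). Qed.

(** The isomorphism is built in this direction because the TGWPA is the side with a universal
    property. *)
Definition fixed_lift : tgwpa fixed_data -> fixed phi :=
  tg_lift (D := fixed_data) fixed_emb fixed_x fixed_y.

Lemma fixed_lift_poisson :
  exists g : {poisson tgwpa fixed_data -> fixed phi}, g =1 fixed_lift.
Proof.
have embMn r j : tg_emb D (r *+ j) = j%:R *: tg_emb D r.
  by rewrite raddfMn scaler_nat.
apply: tg_lift_poisson => [i|r i|r i|i|i j ij|i j ij|i j ij]; apply: val_inj => /=.
- by rewrite -exprMn tg_yx rmorphXn.
- rewrite embMn -(prednK (m_gt0 i)) pbrXr tg_br_rx -scalerAl exprS.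
  by congr (_ *: _); ring.
- rewrite embMn -(prednK (m_gt0 i)) pbrXr tg_br_ry -scalerAl -scalerN exprS.
  by congr (_ *: _); ring.
(* Both sides are the image of m_i^2 a_i^(m_i - 1) d_i(a_i). *)
- rewrite embMn -(prednK (m_gt0 i)) (pbrX2 _ _ (tg_br_yx D i)) d_aX linearZ /=.
  by rewrite scalerA -natrM -exprMn tg_yx -rmorphXn -rmorphM.
- have yx := tg_br_yxj D ij; rewrite mulrC in yx.
  by rewrite (pbrX_eigen _ _ yx) [tg_x D j ^+ _ * _]mulrC.
- by rewrite (pbrX_eigen _ _ (tg_br_xx D ij)) mulrBr.
- by rewrite (pbrX_eigen _ _ (tg_br_yy D ij)) mulrBr [(m j * m i)%N]mulnC.
Qed.

(** * Compatibility with normal forms, and injectivity *)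

Local Notation P := {mpoly R[n + n]}.
Local Notation P' := {mpoly (fixed rho)[n + n]}.
Implicit Types M : 'X_{1..n + n}.

Local Notation coefC := (@mpolyC (n + n) R \o (val : fixed rho -> R)).

(** A lift of [fixed_lift] to polynomials, where normal forms can be compared. *)
Definition scale_poly : P' -> P := mmap coefC (fun s => 'X_s ^+ m (tg_ix s)).
HB.instance Definition _ := GRing.RMorphism.on scale_poly.

Lemma scale_polyZX (c : fixed rho) M :
  scale_poly (c *: 'X_[M]) = val c *: 'X_[mnm_scale m M].
Proof.
rewrite /scale_poly (mmapZ _ coefC) /= mul_mpolyC.
rewrite (mmapX _ coefC) /mmap1 [in RHS]mpolyXE_id.
by congr (_ *: _); apply: eq_bigr => s _; rewrite -exprM mnmE.
Qed.

Lemma val_fixed_lift (p : P') : val (fixed_lift (tg_pi fixed_data p)) = tg_pi D (scale_poly p).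
Proof.
rewrite /fixed_lift tg_lift_pi; last exact: fixed_yx.
elim/mpoly_gen_ind: p => [c|s|p q Ep Eq|p q Ep Eq].
- rewrite tg_lift_polyC /scale_poly.
  by rewrite [mmap _ _ _](mmapC _ coefC).
- rewrite -['X_s in RHS]scale1r scale_polyZX scale1r.
  have -> : mnm_scale m U_(s) = (U_(s) *+ m (tg_ix s))%MM.
    by apply/mnmP => t; rewrite mulmnE mnmE mnm1E mulnC; case: eqP => [->|].
  rewrite -mpolyXn rmorphXn -[s]splitK.
  case: (split s) => i /=; rewrite ?tg_ixl ?tg_ixr.
    by rewrite tg_lift_polyx.
  by rewrite tg_lift_polyy.
- by rewrite !rmorphD /= Ep Eq.
- by rewrite !rmorphM /= Ep Eq.
Qed.

(** Scaling turns a cap c at i into m_i c and commutes with reduction, while b_i^c = a_i^(m_i c). *)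
Lemma nf_scale_poly (p : P') : tg_nf D (scale_poly p) = scale_poly (tg_nf fixed_data p).
Proof.
elim/mpolyind: p => [|c M p _ _ IHp]; first by rewrite !(linear0, rmorph0).
rewrite linearD !rmorphD /= linearD /= IHp; congr (_ + _).
rewrite scale_polyZX [in RHS]linearZ /= linearZ /= !tg_nfX !scalerA scale_polyZX.
rewrite mnm_red_scale rmorphM rmorph_prod /=; congr (_ * _ *: _).
by apply: eq_bigr => i _; rewrite fixed_valX mnm_cap_scale exprM.
Qed.

(** As every [m i] is positive, distinct monomials have distinct images and no coefficients
    merge. *)
Lemma scale_poly_coef (p : P') M : (scale_poly p)@_(mnm_scale m M) = val p@_M.
Proof.
elim/mpolyind: p => [|c M' p _ _ IHp]; first by rewrite rmorph0 !mcoeff0 rmorph0.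
rewrite rmorphD /= !mcoeffD IHp scale_polyZX !mcoeffZ !mcoeffX.
rewrite (inj_eq (mnm_scale_inj m_gt0)).
by case: (M' == M); rewrite ?mulr1 // !mulr0 !add0r.
Qed.

Lemma scale_poly_inj : injective scale_poly.
Proof.
by move=> p q pq; apply/mpolyP => M; apply: val_inj; rewrite /= -!scale_poly_coef pq.
Qed.

(** If a class is sent to 0, the scaled normal form of a representative vanishes; scaling is
    injective, so the normal form itself is 0. *)
Lemma fixed_lift_inj : injective fixed_lift.
Proof.
have [g gE] := fixed_lift_poisson; move=> u v; rewrite -!gE => guv.
apply/eqP; rewrite -subr_eq0; apply/eqP.
have {guv}: g (u - v) = 0 by rewrite rmorphB /= guv subrr.
elim/tg_pi_ind: (u - v) => p; rewrite gE => /(congr1 val).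
rewrite val_fixed_lift /= => /tg_pi_eq0P; rewrite nf_scale_poly => p0.
by apply/tg_pi_eq0P; apply: scale_poly_inj; rewrite p0 rmorph0.
Qed.

(** * Weights of monomials under [phi], and surjectivity *)

Definition var_weight (s : 'I_(n + n)) : k :=
  match split s with inl i => alpha i | inr i => (alpha i)^-1 end.
Definition mnm_weight M : k := \prod_s var_weight s ^+ M s.

Local Notation coefR := (@mpolyC (n + n) R \o rho).
(** A lift of [phi] to polynomials that is diagonal on monomials, up to [rho] on the
    coefficients. *)
Definition phi_poly : P -> P :=
  mmap coefR (fun s => (var_weight s)%:A *: 'X_s).
HB.instance Definition _ := GRing.RMorphism.on phi_poly.

Lemma tg_pi_phi_poly (p : P) : tg_pi D (phi_poly p) = phi (tg_pi D p).
Proof.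
elim/mpoly_gen_ind: p => [c|s|p q Ep Eq|p q Ep Eq].
- by rewrite [phi_poly _](mmapC _ coefR) [RHS]phi_rho.
- rewrite [phi_poly _](mmapX _ coefR) mmap1U tg_pi_scale rmorph_alg mulr_algl.
  rewrite /var_weight -[s]splitK; case: (split s) => i.
    by rewrite (unsplitK (inl i)) [RHS]phi_x.
  by rewrite (unsplitK (inr i)) [RHS]phi_y.
- by rewrite !rmorphD /= Ep Eq.
- by rewrite !rmorphM /= Ep Eq.
Qed.

Lemma phi_poly_coef (p : P) M : (phi_poly p)@_M = mnm_weight M *: rho p@_M.
Proof.
elim/mpolyind: p => [|c M' p _ _ IHp].
  by rewrite rmorph0 !mcoeff0 rmorph0 scaler0.
rewrite rmorphD /= !mcoeffD IHp rmorphD scalerDr; congr (_ + _).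
rewrite [phi_poly _](mmapZ _ coefR) (mmapX _ coefR) /= mul_mpolyC /mmap1.
have -> : \prod_s ((var_weight s)%:A *: 'X_s) ^+ M' s =
    (mnm_weight M')%:A *: 'X_[M'] :> P.
  rewrite -[_%:A]/(in_alg R _) rmorph_prod [in RHS]mpolyXE_id -scaler_prod.
  by apply: eq_bigr => s _; rewrite exprZn rmorphXn.
rewrite !mcoeffZ !mcoeffX rmorphM /= rmorph_nat mulrCA mulr_algl.
by case: eqVneq => [->|_] //; rewrite mulr0 !scaler0.
Qed.

Lemma mnm_weightE M : mnm_weight M =
  \prod_i (alpha i ^+ M (lshift n i) / alpha i ^+ M (rshift n i)).
Proof.
rewrite /mnm_weight big_split_ord /= -big_split; apply: eq_bigr => i _.
by rewrite /var_weight (unsplitK (inl i)) (unsplitK (inr i)) exprVn.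
Qed.

Variable l : nat.
Hypothesis rho_l : forall r, iter l rho r = r.
Hypothesis alpha_order : forall i, (m i).-primitive_root (alpha i).
Hypothesis coprime_lm : forall i, coprime l (m i).
Hypothesis coprime_mm : forall i j, i != j -> coprime (m i) (m j).

(** Since [rho] fixes scalars and has l-th iterate the identity, iterating l times gives w^l c = c
    for the weight w, so w^l = 1. Coprimality then makes the contribution to w of each index
    trivial. *)
Lemma weight_fixed M (c : R) : c != 0 -> mnm_weight M *: rho c = c ->
  rho c = c /\ forall i, M (lshift n i) = M (rshift n i) %[mod m i].
Proof.
move=> c0 wc; have wl : mnm_weight M ^+ l = 1.
  have wcj j : mnm_weight M ^+ j *: iter j rho c = c.
    elim: j => [|j IHj]; first by rewrite scale1r.
    by rewrite exprS -scalerA /= -[X in _ *: X]linearZ /= IHj.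
  apply/eqP; rewrite -subr_eq0; have /eqP := wcj l.
  rewrite rho_l -subr_eq0 -{2}[c]scale1r -scalerBl scaler_eq0 (negPf c0) orbF //.
(* The contribution of x_i and y_i to the weight, an m_i-th root of unity. *)
pose z i := alpha i ^+ M (lshift n i) / alpha i ^+ M (rshift n i).
have z1 : forall i, z i = 1.
  apply: (coprime_prod_eq1 m_gt0 coprime_lm coprime_mm) => [i|].
    by rewrite expr_div_n -!exprM ![(_ * m i)%N]mulnC !exprM alpha_m !expr1n divr1.
  by rewrite -mnm_weightE.
split=> [|i].
  have w1 : mnm_weight M = 1 by rewrite mnm_weightE big1 // => i _; exact: z1.
  by rewrite w1 scale1r in wc.
apply/eqP; rewrite -(eq_prim_root_expr (alpha_order i)); apply/eqP.
by apply: divr1_eq; exact: z1.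
Qed.

Lemma fixed_lift_surj v : exists u, fixed_lift u = v.
Proof.
have [p0 p0v] : exists p, tg_pi D p = val v.
  by elim/tg_pi_ind: (val v) => p; exists p.
pose p := tg_nf D p0.
have pred M : p@_M != 0 -> mnm_red M = M by exact: mcoeff_nf.
have piv : tg_pi D p = val v by rewrite tg_pi_nf.
(* Invariance modulo the ideal becomes equality of polynomials: [phi_poly] creates no new monomials,
   so the difference is reduced, and its class is 0. *)
have phip : phi_poly p = p.
  apply/eqP; rewrite -subr_eq0; apply/eqP.
  rewrite -(@tg_nf_id _ _ _ D (phi_poly p - p)) => [|M].
    apply/tg_pi_eq0P; rewrite rmorphB /= tg_pi_phi_poly piv.
    by rewrite (eqP (valP v)) subrr.
  have [pM0|/pred //] := eqVneq p@_M 0.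
  by rewrite mcoeffB phi_poly_coef pM0 rmorph0 scaler0 subrr eqxx.
(* The preimage is assembled term by term, each term of [p] having a coefficient fixed by [rho] and
   a scaled monomial. *)
have [q qp] : exists q, scale_poly q = p.
  rewrite [p]mpolyE; elim/big_ind: _ => [|p1 p2 [q1 <-] [q2 <-]|M _].
  - by exists 0; rewrite rmorph0.
  - by exists (q1 + q2); rewrite rmorphD.
  have [->|pM0] := eqVneq p@_M 0; first by exists 0; rewrite rmorph0 scale0r.
  have [|rhoM Mm] := weight_fixed pM0 (M := M); first by rewrite -phi_poly_coef phip.
  have [M' M'M] := mnm_scale_dvd (pred M pM0) Mm.
  have cP : p@_M \in fixed_pred rho by rewrite inE rhoM.
  by exists (Fixed cP *: 'X_[M']); rewrite scale_polyZX M'M.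
by exists (tg_pi fixed_data q); apply: val_inj; rewrite val_fixed_lift qp.
Qed.

Lemma fixed_iso : poisson_iso (fixed phi) (tgwpa fixed_data).
Proof.
apply: poisson_iso_sym; have [g gE] := fixed_lift_poisson; exists g.
(* Surjectivity gives a right inverse by choice, and injectivity makes it two-sided. *)
pose h v := projT1 (cid (fixed_lift_surj v)).
have hK : cancel h g by move=> v; rewrite gE /h; case: cid.
by exists h => // u; apply: fixed_lift_inj; rewrite -!gE hK.
Qed.
End InvariantData.

Theorem theorem3p6 (k : fieldType) (n : nat) (n_gt0 : (0 < n)%N)
    (R : poissonAlgType k) (D : tgwpa_data R n)
    (phi : {poisson tgwpa D -> tgwpa D}) (phi_bij : bijective phi)
    (rho : {poisson R -> R}) (rho_bij : bijective rho)
    (phi_rho : forall r : R, phi (tg_emb D r) = tg_emb D (rho r))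
    (l : nat) (rho_order : has_order rho l)
    (alpha : 'I_n -> k) (m : 'I_n -> nat)
    (phi_x : forall i : 'I_n, phi (tg_x D i) = alpha i *: tg_x D i)
    (phi_y : forall i : 'I_n, phi (tg_y D i) = (alpha i)^-1 *: tg_y D i)
    (alpha_order : forall i : 'I_n, (m i).-primitive_root (alpha i))
    (coprime_lm : forall i : 'I_n, coprime l (m i))
    (coprime_mm : forall i j : 'I_n, i != j -> coprime (m i) (m j)) :
  exists D' : tgwpa_data (fixed rho) n,
    [/\ forall (i : 'I_n) (r : fixed rho),
          val (tg_d D' i r) = tg_d D i (val r) *+ m i,
        forall i : 'I_n, val (tg_a D' i) = tg_a D i ^+ m i,
        forall i j : 'I_n, i != j ->
          tg_mu D' i j = (m i * m j)%:R * tg_mu D i j,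
        forall i j : 'I_n, i != j ->
          tg_gamma D' i j = (m i * m j)%:R * tg_gamma D i j &
        poisson_iso (fixed phi) (tgwpa D')].
Proof.
have m_gt0 i : (0 < m i)%N by exact: prim_order_gt0 (alpha_order i).
have alpha_m i : alpha i ^+ m i = 1 by exact: prim_expr_order.
have alpha0 i : alpha i != 0.
  by apply/eqP => a0; have /eqP := alpha_m i; rewrite a0 expr0n eqn0Ngt m_gt0 eq_sym oner_eq0.
have [_ rho_l _] := rho_order.
exists (fixed_data phi_rho phi_x phi_y alpha0 m_gt0); split=> //.
exact: fixed_iso rho_l alpha_order coprime_lm coprime_mm.
Qed.
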